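(* Let $(R,\mathfrak m,K)$ be a one-dimensional Cohen-Macaulay $F$-finite local ring of prime characteristic $p>0$, and let $M$ be an $R$-module of finite length. Then the following are equivalent: (i) $\beta_i^F(M,R)=0$ for all $i\ge 1$. (ii) $\beta_i^F(M,R)=0$ for some $i\ge 1$. (iii) $\operatorname{pd}_R(M)<\infty$.
   Context: Rings are commutative and Noetherian. A ring of prime characteristic $p$ is $F$-finite if it is a finitely generated module over itself via the Frobenius endomorphism. For an $R$-module $N$ and $e\ge 0$, ${}^eN$ denotes $N$ with the $R$-module structure $r*n=r^{p^e}n$. For a local ring $(R,\mathfrak m,K)$ put $d=\dim R$, $\alpha=\log_p[K:K^p]$ and $q=p^e$; $\lambda$ denotes length of $R$-modules. For $M$ of finite length and $N$ finitely generated, $\beta_i^F(M,N)=\lim_{e\to\infty}\lambda(\operatorname{Tor}^R_i(M,{}^eN))/q^{d+\alpha}$; this limit is known to exist. The zero module has projective dimension $-\infty$. *)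

(* Defs.v *)
From HB Require Import structures.
From mathcomp Require Import all_boot all_order all_algebra.
From mathcomp Require Import all_classical all_reals all_analysis.

Set Implicit Arguments.
Unset Strict Implicit.
Unset Printing Implicit Defensive.

Import Order.TTheory GRing.Theory Num.Theory.
Import numFieldNormedType.Exports.

Local Open Scope classical_set_scope.
Local Open Scope ring_scope.

(* Numerical invariants that may be infinite (length, Krull dimension, depth,
   projective dimension) take values in the extended reals [\bar RR]. *)

(** * Submodules and finiteness *)

(* An ideal of [R] is a [submodule] of [R^o]. *)
Definition submodule (R : comNzRingType) (V : lmodType R) (A : set V) : Prop :=
  A 0 /\ forall (a : R) (x y : V), A x -> A y -> A (a *: x + y).

Definition span_of (R : comNzRingType) (V : lmodType R) (s : seq V) : set V :=
  [set x | exists c : 'I_(size s) -> R, x = \sum_(i < size s) c i *: s`_i].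

Definition finitely_generated (R : comNzRingType) (V : lmodType R) : Prop :=
  exists s : seq V, span_of s = [set: V].

Definition noetherian (R : comNzRingType) : Prop :=
  forall I : set R^o, submodule I -> exists s : seq R^o, I = span_of s.

(* The supremum of the lengths [n] of strict chains [c 0 < c 1 < ... < c n] of
   members of [P]. *)
Definition chain_length (RR : realType) (T : Type) (P : set (set T)) : \bar RR :=
  ereal_sup [set n%:R%:E | n in [set n : nat | exists c : nat -> set T,
    (forall i, (i <= n)%N -> P (c i)) /\
    (forall i, (i < n)%N -> c i `<` c i.+1)]].

Definition module_length (RR : realType) (R : comNzRingType) (V : lmodType R) :
  \bar RR := chain_length RR [set A : set V | submodule A].

Definition finite_length (RR : realType) (R : comNzRingType) (V : lmodType R) :
  Prop := (module_length RR V < +oo)%E.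

(** * Local rings, dimension, depth *)

Definition prime_ideal (R : comNzRingType) (I : set R^o) : Prop :=
  [/\ submodule I, ~ I 1 &
      forall x y : R, I (x * y : R) -> I x \/ I y].

Definition maximal_ideal (R : comNzRingType) (I : set R^o) : Prop :=
  [/\ submodule I, ~ I 1 &
      forall J : set R^o, submodule J -> ~ J 1 -> I `<=` J -> J = I].

Definition local_ring (R : comNzRingType) (m : set R^o) : Prop :=
  maximal_ideal m /\ forall m' : set R^o, maximal_ideal m' -> m' = m.

(* [pi] identifies the field [K] with [R / m]. *)
Definition residue_map (R : comNzRingType) (m : set R^o) (K : fieldType)
    (pi : {rmorphism R -> K}) : Prop :=
  (forall y : K, exists x : R, pi x = y) /\ (forall x : R, pi x = 0 <-> m x).

Definition krull_dim (RR : realType) (R : comNzRingType) : \bar RR :=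
  chain_length RR [set I : set R^o | prime_ideal I].

Definition regular_sequence (R : comNzRingType) (s : seq R) : Prop :=
  ~ @span_of R R^o s 1 /\
  forall i : nat, (i < size s)%N -> forall x : R,
    @span_of R R^o (take i s) (s`_i * x : R) -> @span_of R R^o (take i s) x.

Definition depth (RR : realType) (R : comNzRingType) (m : set R^o) : \bar RR :=
  ereal_sup [set (size s)%:R%:E | s in [set s : seq R |
    (forall x, x \in s -> m x) /\ regular_sequence s]].

Definition cohen_macaulay (RR : realType) (R : comNzRingType) (m : set R^o) :
  Prop := depth RR m = krull_dim RR R.

(** * Restriction of scalars along Frobenius *)

(* [frob_module hp e N] is ${}^eN$. *)
Definition frob_module (R : comNzRingType) (p : nat) (hp : p \in [pchar R])
  (e : nat) (N : lmodType R) : Type := N.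

Section FrobModule.
Variables (R : comNzRingType) (p : nat) (hp : p \in [pchar R]).
Variables (e : nat) (N : lmodType R).
Local Notation eN := (frob_module hp e N).

HB.instance Definition _ := GRing.Zmodule.on eN.

Definition frob_scale (r : R) (x : eN) : eN := (r ^+ (p ^ e)) *: (x : N).

Fact frob_scaleA (a b : R) (v : eN) :
  frob_scale a (frob_scale b v) = frob_scale (a * b) v.
Proof. by rewrite /frob_scale scalerA exprMn. Qed.

Fact frob_scale1 : left_id 1 frob_scale.
Proof. by move=> v; rewrite /frob_scale expr1n scale1r. Qed.

Fact frob_scaleDr : right_distributive frob_scale +%R.
Proof. by move=> a u v; rewrite /frob_scale scalerDr. Qed.

Fact frob_scaleDl (v : eN) : {morph frob_scale^~ v : a b / a + b}.
Proof.
move=> a b; rewrite /frob_scale exprDn_pchar ?scalerDl //.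
by rewrite pnatX pnatE ?(pcharf_prime hp) // hp.
Qed.

HB.instance Definition _ := GRing.Zmodule_isLmodule.Build R eN
  frob_scaleA frob_scale1 frob_scaleDr frob_scaleDl.

End FrobModule.

Definition F_finite (R : comNzRingType) (p : nat) (hp : p \in [pchar R]) : Prop :=
  finitely_generated (frob_module hp 1 R^o).

(* [n] is the dimension of [K] as a vector space over its subfield $K^p$. *)
Definition is_frob_degree (p : nat) (K : fieldType) (n : nat) : Prop :=
  exists b : 'I_n -> K, forall x : K, exists! c : {ffun 'I_n -> K},
    (forall i, exists y : K, c i = y ^+ p) /\ x = \sum_(i < n) c i * b i.

(* $[K:K^p]$; the value 0 when $[K:K^p]$ is infinite is irrelevant, as
   residue fields of F-finite local rings are F-finite. *)
Definition frob_degree (p : nat) (K : fieldType) : nat :=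
  xget 0%N [set n | is_frob_degree p K n].

Definition frob_alpha (RR : realType) (p : nat) (K : fieldType) : RR :=
  ln (frob_degree p K)%:R / ln p%:R.

(** * Projective resolutions and projective dimension *)

Definition projective (R : comNzRingType) (P : lmodType R) : Prop :=
  forall (A B : lmodType R) (g : {linear A -> B}) (f : {linear P -> B}),
    (forall y, exists x, g x = y) ->
    exists h : {linear P -> A}, forall x, g (h x) = f x.

Record proj_resolution (R : comNzRingType) (M : lmodType R) := ProjResolution {
  res_obj :> nat -> lmodType R;
  res_d : forall n, {linear res_obj n.+1 -> res_obj n};
  res_aug : {linear res_obj 0%N -> M};
  res_proj : forall n, projective (res_obj n);
  res_aug_surj : forall y, exists x, res_aug x = y;
  res_exact0 : forall x, res_aug x = 0 <-> exists y, res_d 0%N y = x;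
  res_exact : forall n x, res_d n x = 0 <-> exists y, res_d n.+1 y = x
}.

Definition has_resolution_of_length (R : comNzRingType) (M : lmodType R)
    (n : nat) : Prop :=
  exists P : proj_resolution M, forall j, (n < j)%N -> forall x : P j, x = 0.

Definition proj_dim (RR : realType) (R : comNzRingType) (M : lmodType R) :
    \bar RR :=
  if `[< forall x : M, x = 0 >] then -oo%E
  else ereal_inf [set n%:R%:E | n in [set n | has_resolution_of_length M n]].

(** * Tensor products and Tor *)

Definition is_tensor (R : comNzRingType) (U V T : lmodType R)
    (b : {bilinear U -> V -> T}) : Prop :=
  forall (W : lmodType R) (c : {bilinear U -> V -> W}),
    exists f : {linear T -> W},
      (forall u v, f (b u v) = c u v) /\
      (forall g : {linear T -> W}, (forall u v, g (b u v) = c u v) -> g =1 f).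

(* [H] is isomorphic to [Z / (Z `&` B)]: [h] restricts to a surjective
   linear map from [Z] to [H] with kernel [Z `&` B]; its values outside
   [Z] play no role. *)
Definition is_subquotient (R : comNzRingType) (V : lmodType R) (Z B : set V)
    (H : lmodType R) : Prop :=
  exists h : V -> H,
    [/\ forall (a : R) x y, Z x -> Z y -> h (a *: x + y) = a *: h x + h y,
        forall w, exists2 x, Z x & h x = w &
        forall x, Z x -> (h x = 0 <-> B x)].

Definition cycles (R : comNzRingType) (T : nat -> lmodType R)
    (d : forall n, {linear T n.+1 -> T n}) (i : nat) : set (T i) :=
  match i return set (T i) with
  | 0%N => [set: T 0%N]
  | j.+1 => [set x | d j x = 0]
  end.

Definition boundaries (R : comNzRingType) (T : nat -> lmodType R)
    (d : forall n, {linear T n.+1 -> T n}) (i : nat) : set (T i) :=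
  range (d i).

(* [H] is (isomorphic to) $\operatorname{Tor}^R_i(M,N)$, the [i]-th homology of
   $P\otimes_R N$ for a projective resolution $P$ of $M$.  Since Tor is unique
   only up to isomorphism, it is rendered as a relation. *)
Definition is_Tor (R : comNzRingType) (i : nat) (M N H : lmodType R) : Prop :=
  exists (P : proj_resolution M) (T : nat -> lmodType R)
    (b : forall n, {bilinear P n -> N -> T n})
    (d : forall n, {linear T n.+1 -> T n}),
    [/\ forall n, is_tensor (b n),
        forall n x y, d n (b n.+1 x y) = b n (res_d P n x) y &
        is_subquotient (cycles d (i := i)) (boundaries d (i := i)) H].

(** * Frobenius Betti numbers *)

(* $\beta^F_i(M,N)=\beta$, that is,
   $\lambda(\operatorname{Tor}_i^R(M,{}^eN))/q^{d+\alpha}\to\beta$ with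
   $q=p^e$; [K] is the residue field of [R].  The limit is taken in [\bar RR]
   and its existence is part of the assertion. *)
Definition is_frob_betti (RR : realType) (R : comNzRingType) (p : nat)
    (hp : p \in [pchar R]) (K : fieldType) (i : nat) (M N : lmodType R)
    (beta : RR) : Prop :=
  let d : RR := fine (krull_dim RR R) in
  let alpha := frob_alpha RR p K in
  exists H : nat -> lmodType R,
    (forall e, is_Tor i M (frob_module hp e N) (H e)) /\
    ((fun e : nat => module_length RR (H e) *
        (((p ^ e)%:R `^ (d + alpha))^-1)%:E)%E @ \oo --> beta%:E).

(* Main.v *)
(* The finite projective dimension direction: by the Auslander-Buchsbaum
   argument a minimal free resolution stops after one step, and
   its differential D satisfies D S = x for a nonzerodivisor x killing M, hence
   D^[q] S^[q] = x^q and the Frobenius pullback stays injective.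

   Conversely, let A = d_i and B = d_(i+1) be consecutive differentials of the
   minimal free resolution and Z the kernel of A^[q].  The entries of B lie in
   the maximal ideal, so some fixed power of each is divisible by x (this is
   where dim R = 1 is used), whence the image of B^[q] lies in x^s F with
   s = floor(q/N).  As F/Z embeds in a free module, Z meets x^s F in x^s Z.  So
   Tor_i surjects onto Z/x^s Z, of length at least s if Z <> 0; counted over R
   through Frobenius this becomes at least (s - 1) [K:K^p]^e, which does not
   vanish after division by q^(1 + alpha).  Therefore Z = 0 for some q, and a
   determinant argument shows that A itself is injective. *)

From HB Require Import structures.
Require Import Defs.
From mathcomp Require Import all_boot all_order all_algebra.
From mathcomp Require Import all_classical all_reals all_analysis.
From mathcomp Require Import ring zify.

Set Implicit Arguments.
Unset Strict Implicit.
Unset Printing Implicit Defensive.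
Import Order.TTheory GRing.Theory Num.Theory.
Local Open Scope classical_set_scope.
Local Open Scope ring_scope.

(** * Submodules *)

Definition mklin (R : pzRingType) (U V : lmodType R) (f : U -> V)
    (Hf : linear f) : {linear U -> V} :=
  HB.pack f (GRing.isLinear.Build R U V *:%R f Hf).

Section Submodules.
Variables (R : comNzRingType) (V : lmodType R).
Implicit Types (A B : set V) (s : seq V).

Lemma submod0 A : submodule A -> A 0. Proof. by case. Qed.

Lemma submod_set0 : submodule ([set 0] : set V).
Proof. by split=> // a x y /= -> ->; rewrite scaler0 addr0. Qed.

Lemma submodD A x y : submodule A -> A x -> A y -> A (x + y).
Proof. by move=> [_ h] Ax Ay; rewrite -[x]scale1r; apply: h. Qed.

Lemma submodZ A a x : submodule A -> A x -> A (a *: x).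
Proof. by move=> [A0 h] Ax; rewrite -[_ *: _]addr0; apply: h. Qed.

Lemma submodB A x y : submodule A -> A x -> A y -> A (x - y).
Proof. by move=> hA Ax Ay; rewrite -scaleN1r addrC; apply: hA.2. Qed.

Lemma submod_sum A (I : finType) (F : I -> V) :
  submodule A -> (forall i, A (F i)) -> A (\sum_i F i).
Proof.
move=> hA hF; elim/big_ind: _ => //; first exact: submod0.
by move=> x y; apply: submodD.
Qed.

Lemma span_sub A s :
  submodule A -> (forall x, x \in s -> A x) -> span_of s `<=` A.
Proof.
move=> hA hs _ [c ->]; apply: submod_sum => // i; apply: submodZ => //.
by apply: hs; rewrite mem_nth.
Qed.

Lemma submod_span s : submodule (span_of s).
Proof.
split; first by exists (fun=> 0); rewrite big1 // => i _; rewrite scale0r.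
move=> a _ _ [c ->] [c' ->]; exists (fun i => a * c i + c' i).
rewrite scaler_sumr -big_split; apply: eq_bigr => i _ /=.
by rewrite scalerDl scalerA.
Qed.

Lemma mem_span s x : x \in s -> span_of s x.
Proof.
move=> xs; have hi : (index x s < size s)%N by rewrite index_mem.
exists (fun i => (i == Ordinal hi)%:R).
rewrite (bigD1 (Ordinal hi)) //= eqxx scale1r nth_index // big1 ?addr0 //.
by move=> i /negPf ->; rewrite scale0r.
Qed.

Lemma span_mono s s' : {subset s <= s'} -> span_of s `<=` span_of s'.
Proof.
by move=> h; apply: span_sub; [exact: submod_span|move=> x /h; exact: mem_span].
Qed.

Lemma submod_ker (W : lmodType R) (f : {linear V -> W}) :
  submodule [set x | f x = 0].
Proof.
split=> /=; first by rewrite linear0.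
by move=> a x y fx fy; rewrite linearP fx fy scaler0 addr0.
Qed.

Lemma submod_range (W : lmodType R) (f : {linear W -> V}) : submodule (range f).
Proof.
split=> /=; first by exists 0; rewrite ?linear0.
by move=> a _ _ [x _ <-] [y _ <-]; exists (a *: x + y); rewrite ?linearP.
Qed.

Definition fg A := exists s, A = span_of s.

Definition lincomb k (g : 'I_k -> V) (v : 'rV[R]_k) : V :=
  \sum_i v 0 i *: g i.

Fact lincomb_linear k (g : 'I_k -> V) : linear (lincomb g).
Proof.
move=> a u v; rewrite /lincomb scaler_sumr -big_split; apply: eq_bigr => i _ /=.
by rewrite !mxE scalerDl scalerA.
Qed.

HB.instance Definition _ k (g : 'I_k -> V) :=
  GRing.isLinear.Build R 'rV[R]_k V *:%R (lincomb g) (lincomb_linear g).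

Lemma linear_rV k (f : {linear 'rV[R]_k -> V}) v :
  f v = lincomb (fun i => f (delta_mx 0 i)) v.
Proof.
rewrite [in LHS](row_sum_delta v) linear_sum; apply: eq_bigr => i _.
by rewrite linearZ.
Qed.

Lemma span_lincomb s : span_of s = range (lincomb (fun i : 'I_(size s) => s`_i)).
Proof.
apply/seteqP; split=> [_ [c ->]|_ [v _ <-]]; last by exists (fun i => v 0 i).
by exists (\row_i c i) => //; apply: eq_bigr => i _; rewrite mxE.
Qed.

Lemma fg_range k (f : {linear 'rV[R]_k -> V}) : fg (range f).
Proof.
exists [seq f (delta_mx 0 i) | i <- enum 'I_k]; apply/seteqP; split.
  move=> _ [v _ <-]; rewrite linear_rV; apply: submod_sum; first exact: submod_span.
  move=> i; apply: submodZ; first exact: submod_span.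
  by apply: mem_span; apply: map_f; rewrite mem_enum.
by apply: span_sub; [exact: submod_range|move=> x /mapP[i _ ->]; exists (delta_mx 0 i)].
Qed.

End Submodules.

Lemma fg_image (R : comNzRingType) (V W : lmodType R) (f : {linear V -> W}) (A : set V) :
  fg A -> fg (f @` A).
Proof.
move=> [s ->]; rewrite span_lincomb.
by rewrite image_comp; exact: (fg_range (f \o lincomb (fun i : 'I_(size s) => s`_i))).
Qed.

(** Induction on [j], where only the first [j] coordinates may be nonzero: the last of these maps
    [B] onto an ideal, which is finitely generated, and the kernel of this map has one free
    coordinate fewer. *)
Lemma noetherian_rV (R : comNzRingType) n (A : set 'rV[R]_n) :
  noetherian R -> submodule A -> fg A.
Proof.
move=> hR hA.
suff H : forall j B, (j <= n)%N -> submodule B -> B `<=` A ->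
    (forall v, B v -> forall i : 'I_n, (j <= i)%N -> v 0 i = 0) ->
    fg B.
  by apply: (H n A) => // v _ i; rewrite leqNgt ltn_ord.
elim=> [|j IH] B hj hB BA Bv.
  exists [::]; apply/seteqP; split=> v.
    move=> /Bv v0; have -> : v = 0 by apply/rowP => i; rewrite v0 // mxE.
    exact: submod0 (submod_span _).
  by move=> [c ->]; rewrite big_ord0; exact: submod0.
pose i0 := Ordinal hj.
pose I : set R^o := [set a | exists2 v, B v & v 0 i0 = a].
have [|t It] := hR I.
  split; first by exists 0; rewrite ?mxE //; exact: submod0.
  move=> a _ _ [u Bu <-] [v Bv' <-]; exists (a *: u + v); first exact: hB.2.
  by rewrite !mxE.
pose B' := [set v | B v /\ v 0 i0 = 0].
have [||||s Bs] := IH B'.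
- exact: ltnW.
- split; first by split; [exact: submod0|rewrite mxE].
  move=> a x y [Bx x0] [By y0]; split; first exact: hB.2.
  by rewrite !mxE x0 y0 mulr0 addr0.
- by move=> v [/BA].
- move=> v [Bv' v0] i; rewrite leq_eqVlt => /orP[/eqP ji|]; last exact: Bv.
  by have -> : i = i0 by apply: val_inj.
have hx (a : R^o) : exists v, a \in t -> B v /\ v 0 i0 = a.
  have [ta|_] := boolP (a \in t); last by exists 0.
  have : I a by rewrite It; apply: mem_span.
  by case=> v ? ?; exists v.
have [g hg] := choice hx.
have hgB (a : R^o) : a \in t -> B (g a) by move=> /hg[].
exists (s ++ map g t); apply/seteqP; split; last first.
  apply: span_sub => // v; rewrite mem_cat => /orP[vs|/mapP[a /hgB ? ->] //].
  by have [] : B' v by rewrite Bs; apply: mem_span.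
move=> v Bv'; have : I (v 0 i0) by exists v.
rewrite It => -[c vE].
(* The combination [w] of lifted generators has the same coordinate at [i0] as [v], so [v - w] lies
   in [B']. *)
pose w := \sum_(i < size t) c i *: g t`_i.
have hw : span_of (s ++ map g t) w.
  apply: submod_sum => [|i]; first exact: submod_span.
  apply: submodZ; first exact: submod_span.
  by apply: mem_span; rewrite mem_cat map_f ?orbT // mem_nth.
rewrite -[v](subrK w); apply: submodD => //; first exact: submod_span.
apply: (@span_mono _ _ s); first by move=> x; rewrite mem_cat => ->.
rewrite -Bs; split.
  apply: submodB => //; apply: submod_sum => // i; apply: submodZ => //.
  by apply: hgB; rewrite mem_nth.
rewrite !mxE vE summxE -sumrB big1 // => i _.
by rewrite !mxE (hg _ (mem_nth _ _)).2 // subrr.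
Qed.

(** * Ideals in local rings *)

Section Ideals.
Variable R : comNzRingType.
Implicit Types (I J Q : set R^o) (S : set R).

Lemma idealMl I (a x : R) : submodule I -> I x -> I (a * x : R).
Proof. by move=> hI; exact: (@submodZ _ R^o). Qed.

Lemma ideal_add1 I (x : R) : submodule I ->
  submodule ([set y | exists2 i, I i & exists r : R, y = i + r * x] : set R^o).
Proof.
move=> hI; split; first by exists 0; [exact: submod0|exists 0; rewrite mul0r addr0].
move=> a _ _ [i Ii [r ->]] [j Ij [t ->]].
exists (a *: i + j); first exact: hI.2.
by exists (a * r + t); rewrite scalerDr addrACA mulrDl -mulrA.
Qed.

(** By Zorn's lemma there is an ideal maximal among those containing [I] and disjoint from the
    multiplicative set [S]; maximality makes it prime. *)
Lemma prime_avoiding S I : submodule I -> S 1 ->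
    (forall a b, S a -> S b -> S (a * b)) -> (forall x, I x -> ~ S x) ->
  exists Q, [/\ prime_ideal Q, I `<=` Q, (forall x, Q x -> ~ S x) &
    forall J, submodule J -> Q `<=` J -> (forall x, J x -> ~ S x) -> J = Q].
Proof.
move=> hI S1 SM IS.
pose ok J := submodule J /\ (I `<=` J /\ forall x, J x -> ~ S x).
pose P J := ok J \/ J = set0.
have [F FP Ftot|Q [PQ Qmax]] := @Zorn_bigcup R^o P.
  have [[J FJ J0]|no] := pselect (exists2 J, F J & J !=set0); last first.
    by right; apply/seteqP; split=> // x [J FJ Jx]; apply: no; exists J => //; exists x.
  have Fok K : F K -> K !=set0 -> ok K.
    by move=> /FP [//|->] /set0P/eqP.
  have okJ := Fok _ FJ J0.
  left; split; last split.
  - split; first by exists J => //; exact: submod0 okJ.1.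
    move=> a x y [A FA Ax] [B FB By].
    have [AB|BA] := Ftot _ _ FA FB.
      by exists B => //; apply: (Fok _ FB _).1.2 => //; [exists y|exact: AB].
    by exists A => //; apply: (Fok _ FA _).1.2 => //; [exists x|exact: BA].
  - by move=> x Ix; exists J => //; exact: okJ.2.1.
  - by move=> x [A FA Ax]; apply: (Fok _ FA _).2.2 => //; exists x.
have okQ : ok Q.
  case: PQ => // Q0; exfalso; have PI : P I by left; split=> //; split=> // x.
  apply: (Qmax I) PI.
  by rewrite Q0; split=> [|h]; [exact: sub0set|case: (h 0 (submod0 hI))].
have QM J : submodule J -> Q `<=` J -> (forall x, J x -> ~ S x) -> J = Q.
  move=> hJ QJ JS; apply/seteqP; split=> //; apply: contrapT => nJQ.
  apply: (Qmax J); first by split.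
  by left; split=> //; split=> //; exact: subset_trans okQ.2.1 QJ.
case: okQ => hQ [IQ QS].
exists Q; split=> //; split=> //; first by move=> /QS.
move=> x y Qxy; apply: contrapT => /not_orP[Qx Qy].
(* By maximality [Q + Rz] meets [S] for every [z] outside [Q]. The product of two such elements, for
   [x] and [y], would lie in both [Q] and [S]. *)
have key (z : R) : ~ Q z -> exists2 i, Q i & exists r : R, S (i + r * z).
  move=> Qz; apply: contrapT => no.
  have := QM _ (ideal_add1 z hQ) _ _.
  move=> E; apply: Qz; rewrite -E.
  - by exists 0; [exact: submod0|exists 1; rewrite mul1r add0r].
  - by move=> i Qi; exists i => //; exists 0; rewrite mul0r addr0.
  - by move=> _ [i Qi [r ->]] Si; apply: no; exists i => //; exists r.
have [i Qi [r Si]] := key _ Qx; have [j Qj [t Sj]] := key _ Qy.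
apply: (QS _ _ (SM _ _ Si Sj)).
have -> : (i + r * x) * (j + t * y) = j * i + (t * y) * i + (r * x) * j + (r * t) * (x * y).
  by ring.
by do !(apply: (@submodD _ R^o) => //); exact: idealMl.
Qed.

End Ideals.

Section Local.
Variables (R : comNzRingType) (m : set R^o).
Hypothesis R_local : local_ring m.

(** An ideal maximal among those avoiding 1 is a maximal ideal, hence equals [m]. *)
Lemma proper_sub_max (I : set R^o) : submodule I -> ~ I 1 -> I `<=` m.
Proof.
move=> hI I1; have [||Q [[hQ Q1 _] IQ _ Qmax]] := @prime_avoiding R [set 1] I hI erefl.
- by move=> a b -> ->; rewrite mulr1.
- by move=> x Ix /= x1; apply: I1; rewrite -x1.
suff <- : Q = m by [].
apply: R_local.2; split=> // J hJ J1 QJ; apply: Qmax => //.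
by move=> x Jx /= x1; apply: J1; rewrite -x1.
Qed.

Lemma local_unit (x : R) : ~ m x -> exists y, x * y = 1.
Proof.
move=> mx; apply: contrapT => no; apply: mx.
have h0 := @submod_set0 R R^o.
apply: (proper_sub_max (ideal_add1 x h0)).
  by move=> [_ -> [r E]]; apply: no; exists r; rewrite E add0r mulrC.
by exists 0 => //; exists 1; rewrite mul1r add0r.
Qed.

Lemma local_prime : prime_ideal m.
Proof.
have [[hm m1 _] _] := R_local; split=> // x y mxy.
have [|/local_unit[z xz]] := pselect (m x); first by left.
right; have -> : y = z * (x * y) by rewrite mulrA (mulrC z) xz mul1r.
exact: idealMl.
Qed.

Variable RR : realType.

Lemma chain_length_le (T : Type) (P : set (set T)) (k n : nat) (c : nat -> set T) :
  chain_length RR P = k%:R%:E ->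
  (forall i, (i <= n)%N -> P (c i)) -> (forall i, (i < n)%N -> c i `<` c i.+1) ->
  (n <= k)%N.
Proof.
move=> hk Pc cS; rewrite -(ler_nat RR) -lee_fin -hk.
by apply: ereal_sup_ubound; exists n => //; exists c.
Qed.

(** If no power of [b] lay in [xR], a prime [P] would contain [x] and miss [b]. As [x] is a
    nonzerodivisor, there is a prime [Q] inside [P] that misses [x], and Q < P < m contradicts
    dimension one. *)
Lemma pow_in_principal (x : R) :
  krull_dim RR R = 1%:E -> m x -> (forall y, x * y = 0 -> y = 0) ->
  forall b, m b -> exists n y, b ^+ n = x * y.
Proof.
move=> dim1 mx xnzd b mb; apply: contrapT => no.
have h0 := @submod_set0 R R^o.
have [|||P [pP IP PS _]] := @prime_avoiding R [set b ^+ n | n in setT] _ (ideal_add1 x h0).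
- by exists 0.
- by move=> _ _ [i _ <-] [j _ <-]; exists (i + j)%N; rewrite ?exprD.
- by move=> _ [_ -> [r ->]] [n _ E]; apply: no; exists n, r; rewrite E add0r mulrC.
have Px : P x by apply: IP; exists 0 => //; exists 1; rewrite mul1r add0r.
have Pb : ~ P b by move=> /PS; apply; exists 1%N; rewrite ?expr1.
have [hP P1 PM] := pP.
(* The multiplicative set consists of the x^i s with [s] outside [P]. It misses 0 because [x] is a
   nonzerodivisor; taking i = 0 puts [Q] inside [P], and taking s = 1 keeps [x] out of [Q]. *)
have [||| Q [pQ _ QS _]] := @prime_avoiding R
  [set x ^+ n.1 * n.2 | n in [set n : nat * R | ~ P n.2]] _ h0.
- by exists (0%N, 1) => //=; rewrite mulr1.
- move=> _ _ [[i s] /= Ps <-] [[j t] /= Pt <-]; exists ((i + j)%N, s * t) => /=.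
    by move=> /PM[].
  by rewrite exprD mulrACA.
- move=> _ -> [[i s] /= Ps E].
  suff s0 : s = 0 by apply: Ps; rewrite s0; exact: hP.1.
  by elim: i E => [|i IH]; rewrite ?mul1r // exprS -mulrA => /xnzd/IH.
have QP : Q `<=` P.
  move=> s Qs; apply: contrapT => Ps; apply: (QS _ Qs).
  by exists (0%N, s) => //=; rewrite mul1r.
have Qx : ~ Q x.
  by move=> /QS; apply; exists (1%N, 1) => //=; rewrite mulr1.
suff : (2 <= 1)%N by [].
apply: (chain_length_le (k := 1)
  (c := fun i => if i is 0 then Q else if i is 1 then P else m) dim1).
- by move=> [|[|i]] _ //; exact: local_prime.
- move=> [|[|i]] // _; split=> //.
  + by move=> /(_ _ Px).
  + exact: proper_sub_max.
  + by move=> /(_ _ mb).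
Qed.

(** Depth one yields a nonempty regular sequence in [m], whose first entry is a nonzerodivisor; with
    the empty sequence alone the supremum would be at most 0. *)
Lemma exists_nzd : cohen_macaulay RR m -> krull_dim RR R = 1%:E ->
  exists x : R, m x /\ forall y, x * y = 0 -> y = 0.
Proof.
move=> cm dim1; have dep : depth RR m = 1%:E by rewrite cm.
have [[s [sm sreg s0]]|no] := pselect (exists s : seq R,
   [/\ (forall x, x \in s -> m x), regular_sequence s & (0 < size s)%N]).
  case: s sm sreg s0 => // x s sm sreg _.
  exists x; split; first by apply: sm; rewrite mem_head.
  move=> y xy; have [] := sreg.2 0%N isT y.
    by exists (fun=> 0); rewrite big_ord0.
  by move=> c; rewrite big_ord0.
suff : (1%:E <= 0%:E :> \bar RR)%E by rewrite lee_fin ler10.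
rewrite -dep; apply: ge_ereal_sup => _ [s [sm sreg] <-].
rewrite lee_fin; case: s sm sreg => // x s sm sreg.
by exfalso; apply: no; exists (x :: s).
Qed.
End Local.

(** * Minimal generators and finite length *)

Section Minimal.
Variables (R : comNzRingType) (m : set R^o) (K : fieldType) (pi : {rmorphism R -> K}).
Hypotheses (R_local : local_ring m) (K_residue : residue_map m pi).

Lemma residue_unit (x : R) : pi x != 0 -> exists y, x * y = 1.
Proof.
by move=> /eqP px; apply: (local_unit R_local) => mx; apply: px; apply/K_residue.2.
Qed.

(** The matrix [row' i 1%:M] is the inclusion of the coordinate hyperplane omitting [i]. *)
Lemma row'_col'_mul k (i : 'I_k.+1) (u : 'rV[R]_k.+1) :
  u 0 i = 0 -> col' i u *m row' i 1%:M = u.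
Proof.
move=> ui; apply/rowP => j; rewrite mxE.
case: (unliftP i j) => [j' ->|->].
  rewrite (bigD1 j') //= !mxE eqxx mulr1 big1 ?addr0 // => l lj.
  by rewrite !mxE (inj_eq lift_inj) (negPf lj) mulr0.
by rewrite ui big1 // => l _; rewrite !mxE eq_sym (negPf (neq_lift _ _)) mulr0.
Qed.

(** All relations among the images of the standard basis have coefficients in the maximal ideal:
    over a local ring, these images form a minimal system of generators of the range. *)
Definition minimal_map (V : lmodType R) k (f : 'rV[R]_k -> V) :=
  forall v, f v = 0 -> forall i, pi (v 0 i) = 0.

(** A relation with a unit coefficient makes one generator redundant; discard it and induct on their
    number. *)
Lemma minimal_generators (V : lmodType R) (A : set V) : fg A ->
  exists k (f : {linear 'rV[R]_k -> V}), range f = A /\ minimal_map f.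
Proof.
move=> [s ->]; rewrite span_lincomb.
suff H : forall k (f : {linear 'rV[R]_k -> V}),
    exists k' (f' : {linear 'rV[R]_k' -> V}), range f' = range f /\ minimal_map f'.
  exact: H.
elim=> [|k IH] f.
  by exists 0%N, f; split=> // v _ [].
have [mf|] := pselect (minimal_map f); first by exists k.+1, f.
move=> /existsNP[v /not_implyP[fv /existsNP[i /eqP/residue_unit[z vz]]]].
have [k' [f' [rf' mf']]] := IH (f \o mulmxr (row' i 1%:M)).
exists k', f'; split=> //; rewrite rf'; apply/seteqP; split=> [_ [w _ <-]|_ [u _ <-]].
  by exists (w *m row' i 1%:M).
(* Subtracting this multiple of the relation [v] clears coordinate [i] and leaves the image under
   [f] unchanged. *)
have u0 : (u - (u 0 i * z) *: v) 0 i = 0.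
  by rewrite !mxE -mulrA (mulrC z) vz mulr1 subrr.
exists (col' i (u - (u 0 i * z) *: v)) => //=.
by rewrite row'_col'_mul // linearB linearZ /= fv scaler0 subr0.
Qed.

Lemma minimal_map_delta (V : lmodType R) k (f : {linear 'rV[R]_k -> V}) i v :
  minimal_map f -> f (delta_mx 0 i) = f v -> pi (v 0 i) = 1.
Proof.
move=> mf E; apply/eqP; rewrite eq_sym -subr_eq0; apply/eqP.
have := mf (delta_mx 0 i - v); rewrite linearB E subrr => /(_ erefl i).
by rewrite !mxE !eqxx rmorphB rmorph1.
Qed.

(** In a minimal system of generators, writing the first one as [x] times an element would force 1 =
    0 in [K]; so the system is empty. *)
Lemma nakayama (V : lmodType R) (A : set V) (x : R) : fg A -> pi x = 0 ->
  (forall a, A a -> exists2 b, A b & a = x *: b) -> forall a, A a -> a = 0.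
Proof.
move=> /minimal_generators[[|k] [f [<- mf]]] px h a [v _ <-].
  by rewrite [v]thinmx0 linear0.
have [|_ [w _ <-]] := h (f (delta_mx 0 0)); first by exists (delta_mx 0 0).
rewrite -linearZ => /(minimal_map_delta mf); rewrite !mxE rmorphM px mul0r.
by move=> /esym/eqP; rewrite oner_eq0.
Qed.

Variable RR : realType.

Lemma finite_length_bound (V : lmodType R) : finite_length RR V ->
  exists n, forall k (c : nat -> set V), (forall i, (i <= k)%N -> submodule (c i)) ->
   (forall i, (i < k)%N -> c i `<` c i.+1) -> (k <= n)%N.
Proof.
rewrite /finite_length /module_length => fl.
have H k (c : nat -> set V) : (forall i, (i <= k)%N -> submodule (c i)) ->
   (forall i, (i < k)%N -> c i `<` c i.+1) ->
   (k%:R%:E <= chain_length RR [set A : set V | submodule A])%E.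
  by move=> h1 h2; apply: ereal_sup_ubound; exists k => //; exists c.
case: (chain_length _ _) fl H => [r| |] // _ H; last first.
  by exists 0%N => k c h1 h2; have := H _ _ h1 h2.
exists (Num.bound `|r|) => k c h1 h2.
have := H _ _ h1 h2; rewrite lee_fin => kr.
rewrite -(ler_nat RR); apply: le_trans kr _.
apply: le_trans (ler_norm _) _; rewrite ltW //; exact: archi_boundP.
Qed.

(** Otherwise one could keep choosing vectors outside the span of the previous ones, and the spans
    would form a chain that is too long. *)
Lemma finite_length_fg (V : lmodType R) : finite_length RR V -> fg [set: V].
Proof.
move=> /finite_length_bound[n hn]; apply: contrapT => nfg.
have [s [ss sP]] : exists s : seq V, size s = n.+1 /\
    forall i, (i < n.+1)%N -> ~ span_of (take i s) s`_i.
  elim: n.+1 => [|k [s [ss sP]]]; first by exists [::].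
  have [v hv] : exists v, ~ span_of s v.
    apply: contrapT => no; apply: nfg; exists s; apply/esym/seteqP; split=> // v _.
    by apply: contrapT => hv; apply: no; exists v.
  exists (rcons s v); rewrite size_rcons ss; split=> // i.
  rewrite ltnS leq_eqVlt => /orP[/eqP ->|ik].
    by rewrite -cats1 -ss take_size_cat // nth_cat ltnn subnn.
  by rewrite -cats1 takel_cat ?ss 1?ltnW // nth_cat ss ik; exact: sP.
suff : (n.+1 <= n)%N by rewrite ltnn.
apply: (hn _ (fun i => span_of (take i s))) => i hi; first exact: submod_span.
have E : take i.+1 s = rcons (take i s) s`_i by rewrite (take_nth 0) // ss.
split; first by apply: span_mono => v; rewrite E mem_rcons inE => ->; rewrite orbT.
move=> /(_ s`_i) h; apply: (sP i hi); apply: h; apply: mem_span.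
by rewrite E mem_rcons mem_head.
Qed.

(** The descending chain of the x^k V must stabilise, and Nakayama's lemma then makes its stable
    value zero. *)
Lemma finite_length_killed (V : lmodType R) (x : R) : finite_length RR V ->
  pi x = 0 -> exists N, forall v : V, x ^+ N *: v = 0.
Proof.
move=> fl px; have fgV := finite_length_fg fl.
have [n hn] := finite_length_bound fl.
have lx k : linear (fun v : V => x ^+ k *: v).
  by move=> a u v; rewrite scalerDr !scalerA mulrC.
have [k hk] : exists k, range (mklin (lx k)) `<=` range (mklin (lx k.+1)).
  apply: contrapT => /forallNP no.
  suff : (n.+1 <= n)%N by rewrite ltnn.
  (* The exponent n + 1 - i reverses the chain of powers, so that it increases with [i]. *)
  apply: (hn _ (fun i => range (mklin (lx (n.+1 - i)%N)))) => i hi.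
    exact: submod_range.
  rewrite subSS subSn //; split; last exact: no.
  by move=> _ [v _ <-]; exists (x *: v) => //=; rewrite scalerA exprSr.
exists k => v; apply: (nakayama (A := range (mklin (lx k))) _ px).
- exact: fg_image.
- move=> _ /hk[w _ <-]; exists (x ^+ k *: w); first by exists w.
  by rewrite /= scalerA exprS.
- by exists v.
Qed.

(* The image of [u] in R/xR lies in the socle. *)
Lemma exists_socle (x : R) : noetherian R -> pi x = 0 ->
  (forall b, pi b = 0 -> exists n y, b ^+ n = x * y) ->
  exists u, ~ (exists y, u = x * y) /\ forall b, pi b = 0 -> exists y, u * b = x * y.
Proof.
move=> noeth px nil.
have hm : submodule m by case: R_local => -[].
have [s ms] := noeth _ hm.
have [u [ux us]] : exists u, ~ (exists y, u = x * y) /\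
    forall b : R, b \in (s : seq R) -> exists y, u * b = x * y.
  have : forall b : R, b \in (s : seq R) -> pi b = 0.
    by move=> b bs; apply/K_residue.2; rewrite ms; exact: (@mem_span _ R^o).
  elim: (s : seq R) => [|g t IH] ht.
    exists 1; split=> // -[y /(congr1 pi)]; rewrite rmorphM rmorph1 px mul0r.
    by move=> /eqP; rewrite oner_eq0.
  have [|u [ux ut]] := IH; first by move=> b bt; apply: ht; rewrite inE bt orbT.
  have [n [y gn]] := nil g (ht _ (mem_head _ _)).
  (* For each generator [g] of [m] in turn, [u] is replaced by u g^k, where k + 1 is the least
     exponent with u g^(k+1) in [xR]. *)
  pose Q k := `[< exists y, u * g ^+ k = x * y >].
  have exQ : exists k, Q k by exists n; apply/asboolP; exists (u * y); rewrite gn mulrCA.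
  case: (ex_minnP exQ) => -[|k] /asboolP [y' E] kmin.
    by exfalso; apply: ux; exists y'; rewrite -E mulr1.
  exists (u * g ^+ k); split.
    by move=> h; have := kmin k (asboolT h); rewrite ltnn.
  move=> b; rewrite inE => /orP[/eqP ->|/ut[w E']].
    by exists y'; rewrite -E exprSr mulrA.
  by exists (g ^+ k * w); rewrite mulrAC E' -mulrA (mulrC w).
exists u; split=> // b pb.
have : m b by apply/K_residue.2.
pose J : set R^o := [set b : R | exists y, u * b = x * y].
have hJ : submodule J.
  split; first by exists 0; rewrite !mulr0.
  move=> a b1 b2 [y1 E1] [y2 E2]; exists (a * y1 + y2).
  by rewrite mulrDr mulrDr -E2 -[a *: b1]/(a * b1) mulrCA E1 mulrCA.
by rewrite ms => /(span_sub hJ us).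
Qed.

End Minimal.

(** * Projective resolutions *)

Section SubmoduleType.
Variables (R : comNzRingType) (V : lmodType R) (A : set V) (hA : submodule A).

(** The proof argument is a phantom that lets the closure instance be inferred from the
    predicate. *)
Definition in_submod of submodule A : {pred V} := [pred x | `[< A x >]].

Fact in_submod_closed : GRing.submod_closed (in_submod hA).
Proof.
split; first by apply/asboolP; exact: submod0.
by move=> a x y /asboolP Ax /asboolP Ay; apply/asboolP; exact: hA.2.
Qed.

HB.instance Definition _ := GRing.isSubmodClosed.Build R V (in_submod hA) in_submod_closed.

Record submod_type := SubmodType { submod_val : V; _ : submod_val \in in_submod hA }.

HB.instance Definition _ := [isSub for submod_val].
HB.instance Definition _ := [Choice of submod_type by <:].
HB.instance Definition _ := [SubChoice_isSubLmodule of submod_type by <:].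

End SubmoduleType.

(** Dependent choice with types varying in [n]; it builds chain maps, homotopies and resolutions
    degree by degree, with [ok] as the invariant that allows the next step. *)
Lemma dependent_sequence (X : nat -> Type) (ok : forall n, X n -> Prop)
    (rel : forall n, X n -> X n.+1 -> Prop) :
  (exists x, ok 0%N x) ->
  (forall n x, ok n x -> exists y, rel n x y /\ ok n.+1 y) ->
  exists s : forall n, X n, (forall n, ok n (s n)) /\ forall n, rel n (s n) (s n.+1).
Proof.
move=> /cid[x0 ok0] step.
pose next n (x : {x : X n | ok n x}) : {y : X n.+1 | ok n.+1 y} :=
  let y := cid (step n _ (svalP x)) in exist _ (sval y) (svalP y).2.
pose s := fix s n := if n is k.+1 then next k (s k) else exist _ x0 ok0.
exists (fun n => sval (s n)); split=> n; first exact: (svalP (s n)).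
by rewrite /=; case: cid => y [].
Qed.

(** * Comparison of projective resolutions *)

Section Resolutions.
Variable R : comNzRingType.

(** Projectivity speaks of surjections only, so both maps are first corestricted to the range of
    [d]. *)
Lemma projective_lift (P A C : lmodType R) (d : {linear A -> C}) (f : {linear P -> C}) :
  projective P -> (forall x, exists a, d a = f x) ->
  exists h : {linear P -> A}, forall x, d (h x) = f x.
Proof.
move=> hP fd; pose hB := submod_range d.
have fB x : f x \in in_submod hB by apply/asboolP; have [a] := fd x; exists a.
have dB x : d x \in in_submod hB by apply/asboolP; exists x.
pose f' x := SubmodType (fB x); pose d' x := SubmodType (dB x).
have lf : linear f' by move=> a x y; apply: val_inj; rewrite /= linearP.
have ld : linear d' by move=> a x y; apply: val_inj; rewrite /= linearP.
have [|h hh] := hP A _ (mklin ld) (mklin lf).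
  move=> [y yB]; have /asboolP[a _ E] := yB; exists a; exact: val_inj.
by exists h => x; have /(congr1 val) := hh x.
Qed.

Lemma projective_rV n : projective 'rV[R]_n.
Proof.
move=> A B g f gs.
have [h hh] := choice (fun i => gs (f (delta_mx 0 i))).
exists (lincomb h) => v; rewrite [f v]linear_rV linear_sum; apply: eq_bigr => i _.
by rewrite linearZ /= hh.
Qed.

Variable M : lmodType R.
Implicit Types P Q : proj_resolution M.

Lemma res_dd P n x : res_d P n (res_d P n.+1 x) = 0.
Proof. by apply/res_exact; exists x. Qed.

Lemma res_aug_d P x : res_aug P (res_d P 0 x) = 0.
Proof. by apply/res_exact0; exists x. Qed.

Definition chain_map P Q (phi : forall n, {linear P n -> Q n}) :=
  forall n x, res_d Q n (phi n.+1 x) = phi n (res_d P n x).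

Lemma comparison P Q : exists phi : forall n, {linear P n -> Q n},
  (forall x, res_aug Q (phi 0%N x) = res_aug P x) /\ chain_map phi.
Proof.
pose X n := {linear P n -> Q n}.
(* The invariant says that [f] sends boundaries to cycles (in degree 0, that it respects the
   augmentations), so exactness of [Q] permits the next lift. *)
pose ok n : X n -> Prop := match n with
  | 0 => fun f => forall x, res_aug Q (f x) = res_aug P x
  | k.+1 => fun f => forall x, res_d Q k (f (res_d P k.+1 x)) = 0 end.
have [||phi [okphi cphi]] := @dependent_sequence X ok
   (fun n f g => forall x, res_d Q n (g x) = f (res_d P n x)).
- by apply: projective_lift => [|x]; [exact: res_proj|exact: res_aug_surj].
- move=> n f okf.
  have [|g hg] := @projective_lift _ _ _ (res_d Q n) (f \o res_d P n) (@res_proj _ _ P n.+1).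
    move=> x /=; case: n f okf x => [|n] f okf x.
      by apply/res_exact0; rewrite okf res_aug_d.
    by apply/res_exact; exact: okf.
  by exists g; split=> //= x; rewrite hg /= res_dd linear0.
- by exists phi; split=> //; exact: (okphi 0%N).
Qed.

Lemma null_homotopy P Q (phi : forall n, {linear P n -> Q n}) : chain_map phi ->
  (forall x, res_aug Q (phi 0%N x) = 0) ->
  exists s : forall n, {linear P n -> Q n.+1},
    (forall x, phi 0%N x = res_d Q 0 (s 0%N x)) /\
    forall n x, phi n.+1 x = res_d Q n.+1 (s n.+1 x) + s n (res_d P n x).
Proof.
move=> cphi aug0.
pose X n := {linear P n -> Q n.+1}.
(* In positive degrees the identity is recorded on boundaries only; this is what makes [phi] minus
   the previous homotopy term a cycle one degree up. *)
pose ok n : X n -> Prop := match n with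
  | 0 => fun f => forall x, phi 0%N x = res_d Q 0 (f x)
  | k.+1 => fun f => forall x, phi k.+1 (res_d P k.+1 x) = res_d Q k.+1 (f (res_d P k.+1 x)) end.
have [||s [oks hs]] := @dependent_sequence X ok
   (fun n f g => forall x, phi n.+1 x = res_d Q n.+1 (g x) + f (res_d P n x)).
- have [|h hh] := @projective_lift _ _ _ (res_d Q 0%N) (phi 0%N) (@res_proj _ _ P 0%N).
    by move=> x; apply/res_exact0.
  by exists h => x; rewrite hh.
- move=> n f okf.
  have lg : linear (fun x => phi n.+1 x - f (res_d P n x)).
    by move=> a x y; rewrite !linearP /= scalerDr addrACA.
  have [|g hg] := @projective_lift _ _ _ (res_d Q n.+1) (mklin lg) (@res_proj _ _ P n.+1).
    move=> x; apply/res_exact; rewrite /= linearB cphi.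
    by case: n f okf x {lg} => [|n] f okf x; rewrite okf subrr.
  exists g; split=> [x|x /=]; first by rewrite hg /= subrK.
  by rewrite hg /= res_dd linear0 subr0.
- by exists s; split=> //; exact: (oks 0%N).
Qed.

(** Comparison maps exist both ways, and the composite on [G] minus the identity induces 0 on [M],
    hence is null-homotopic. *)
Lemma resolution_retract (G P : proj_resolution M) :
  exists (phi : forall n, {linear G n -> P n}) (psi : forall n, {linear P n -> G n})
         (s : forall n, {linear G n -> G n.+1}),
    [/\ chain_map phi, chain_map psi & forall n x,
      psi n.+1 (phi n.+1 x) = res_d G n.+1 (s n.+1 x) + s n (res_d G n x) + x].
Proof.
have [phi [aphi cphi]] := comparison G P.
have [psi [apsi cpsi]] := comparison P G.
pose chi n : {linear G n -> G n} := psi n \o phi n \- idfun.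
have [||s [_ hs]] := @null_homotopy G G chi.
- by move=> n x; rewrite /= linearB cpsi cphi.
- by move=> x; rewrite /= linearB apsi aphi subrr.
by exists phi, psi, s; split=> // n x; rewrite -hs /= subrK.
Qed.

End Resolutions.

(** * Existence of minimal free resolutions *)

Section MinimalResolution.
Variables (R : comNzRingType) (m : set R^o) (K : fieldType) (pi : {rmorphism R -> K}).
Hypotheses (R_local : local_ring m) (K_residue : residue_map m pi).
Hypothesis R_noetherian : noetherian R.

Lemma exists_minimal_resolution (M : lmodType R) : fg [set: M] ->
  exists (r : nat -> nat) (D : forall n, 'M[R]_(r n.+1, r n))
         (aug : {linear 'rV[R]_(r 0%N) -> M}),
    [/\ (forall y, exists x, aug x = y),
        (forall x, aug x = 0 <-> exists y : 'rV_(r 1%N), y *m D 0%N = x),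
        (forall n (x : 'rV_(r n.+1)),
           x *m D n = 0 <-> exists y : 'rV_(r n.+2), y *m D n.+1 = x) &
        forall n, map_mx pi (D n) = 0].
Proof.
move=> /(minimal_generators R_local K_residue)[k [aug [raug maug]]].
(* A stage is a rank together with the syzygy submodule of that free module; the next stage covers
   this syzygy minimally, so the new one again has coordinates in the maximal ideal. *)
pose X (n : nat) := {k & set 'rV[R]_k}.
pose ok n (S : X n) := [/\ submodule (projT2 S),
   (forall v, projT2 S v -> map_mx pi v = 0) &
   n = 0%N -> S = existT _ k [set x | aug x = 0]].
pose rel n (S : X n) (S' : X n.+1) := exists D : 'M[R]_(projT1 S', projT1 S),
   range (mulmxr D) = projT2 S /\ projT2 S' = [set v | v *m D = 0].
have mmx (V : lmodType R) l (f : 'rV[R]_l -> V) v :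
    minimal_map pi f -> f v = 0 -> map_mx pi v = 0.
  by move=> mf fv; apply/rowP => i; rewrite !mxE mf.
have [||s [oks hs]] := @dependent_sequence X ok rel.
- exists (existT _ k [set x | aug x = 0]); split=> //=; first exact: submod_ker.
  by move=> v; exact: mmx.
- move=> n [l A] [/= hA Am _].
  have [l' [f [rf mf]]] :=
    minimal_generators R_local K_residue (noetherian_rV R_noetherian hA).
  have fE v : f v = v *m lin1_mx f by rewrite mul_rV_lin1.
  exists (existT _ l' [set v | v *m lin1_mx f = 0]); split.
    exists (lin1_mx f); split=> //=; rewrite -rf; apply/seteqP; split=> _ [v _ <-].
      by exists v; rewrite // fE.
    by exists v; rewrite // -fE.
  split=> //=; first exact: (submod_ker (mulmxr (lin1_mx f))).
  by move=> v; rewrite -fE; exact: mmx.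
have [D hD] : exists D : forall n, 'M[R]_(projT1 (s n.+1), projT1 (s n)), forall n,
   range (mulmxr (D n)) = projT2 (s n) /\ projT2 (s n.+1) = [set v | v *m (D n) = 0].
  by exists (fun n => projT1 (cid (hs n))) => n; case: cid.
have [_ _ /(_ erefl) s0] := oks 0%N.
(* The third clause of [ok] identifies stage 0 with the kernel of [aug]. The existential form lets
   [aug] be transported by rewriting along this equality, without a cast. *)
have [aug' [h1 h2]] : exists aug' : {linear 'rV[R]_(projT1 (s 0%N)) -> M},
    range aug' = [set: M] /\ projT2 (s 0%N) = [set x | aug' x = 0].
  by rewrite s0; exists aug.
exists (fun n => projT1 (s n)), D, aug'; split.
- by move=> y; have [x _ <-] : range aug' y; [rewrite h1|exists x].
- move=> x; have -> : (aug' x = 0) = projT2 (s 0%N) x by rewrite h2.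
  by rewrite -(hD 0%N).1; split=> [[y _ <-]|[y <-]]; exists y.
- move=> n x; have -> : (x *m D n = 0) = projT2 (s n.+1) x by rewrite (hD n).2.
  by rewrite -(hD n.+1).1; split=> [[y _ <-]|[y <-]]; exists y.
- move=> n; apply/row_matrixP => i; rewrite -map_row row0.
  have [_ + _] := oks n; apply; rewrite -(hD n).1.
  by exists (delta_mx 0 i); rewrite //= -rowE.
Qed.

End MinimalResolution.

(** * Tensor products with Frobenius *)

Lemma dependent_function (X : nat -> Type) (Q : forall n, X n -> Prop) :
  (forall n, exists x, Q n x) -> exists f : forall n, X n, forall n, Q n (f n).
Proof. by move=> h; exists (fun n => sval (cid (h n))) => n; exact: svalP. Qed.

Section Tensor.
Variable R : comNzRingType.
Implicit Types U V W T : lmodType R.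

Definition mkbilin U V W (b : U -> V -> W) (hl : forall v, linear (b^~ v))
    (hr : forall u, linear (b u)) : {bilinear U -> V -> W} :=
  HB.pack b (bilinear_isBilinear.Build R U V W *:%R *:%R b (hl, hr)).

(** Both maps factor the same bilinear map, so the uniqueness half of the universal property
    applies. *)
Lemma tensor_ext U V W T (b : {bilinear U -> V -> T}) (f g : {linear T -> W}) :
  is_tensor b -> (forall u v, f (b u v) = g (b u v)) -> f =1 g.
Proof.
move=> tb fg.
have hl v : linear (fun u => g (b u v)).
  by move=> a x y; rewrite linearPl linearP.
have hr u : linear (fun v => g (b u v)).
  by move=> a x y; rewrite linearPr linearP.
have [h [_ hu]] := tb W (mkbilin hl hr).
by move=> x; rewrite (hu f) // (hu g).
Qed.

Lemma tensor_map U U' V T T' (b : {bilinear U -> V -> T})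
    (b' : {bilinear U' -> V -> T'}) (phi : {linear U -> U'}) :
  is_tensor b -> exists f : {linear T -> T'}, forall u v, f (b u v) = b' (phi u) v.
Proof.
move=> tb.
have hl v : linear (fun u => b' (phi u) v).
  by move=> a x y; rewrite linearP linearPl.
have hr u : linear (fun v => b' (phi u) v).
  by move=> a x y; rewrite linearPr.
by have [h [hh _]] := tb T' (mkbilin hl hr); exists h.
Qed.

Definition tensor_complex M N (P : proj_resolution M) (T : nat -> lmodType R)
    (b : forall n, {bilinear P n -> N -> T n}) (d : forall n, {linear T n.+1 -> T n}) :=
  (forall n, is_tensor (b n)) /\
  forall n x y, d n (b n.+1 x y) = b n (res_d P n x) y.

(** The map [f] is injective on homology, since composing it with the map back is homotopic to the
    identity. Lengths found on a chosen resolution [G] thus bound from below those of Tor computed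
    on any [P]. *)
Lemma Tor_retract M N i (P G : proj_resolution M) (T TG : nat -> lmodType R)
    (b : forall n, {bilinear P n -> N -> T n}) (d : forall n, {linear T n.+1 -> T n})
    (bG : forall n, {bilinear G n -> N -> TG n}) (dG : forall n, {linear TG n.+1 -> TG n}) :
  tensor_complex b d -> tensor_complex bG dG ->
  exists f : {linear TG i.+1 -> T i.+1},
    (forall x, dG i x = 0 -> d i (f x) = 0) /\
    forall x, dG i x = 0 -> range (d i.+1) (f x) -> range (dG i.+1) x.
Proof.
move=> [tb hd] [tbG hdG].
have [phi [psi [s [cphi cpsi hs]]]] := resolution_retract G P.
have [f hf] := dependent_function (fun n => tensor_map (b n) (phi n) (tbG n)).
have [g hg] := dependent_function (fun n => tensor_map (bG n) (psi n) (tb n)).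
have [t ht] := dependent_function (fun n => tensor_map (bG n.+1) (s n) (tbG n)).
have df n x : d n (f n.+1 x) = f n (dG n x).
  apply: (tensor_ext (f := d n \o f n.+1) (g := f n \o dG n) (tbG n.+1)) => u v /=.
  by rewrite hf hd hdG hf cphi.
have dg n x : dG n (g n.+1 x) = g n (d n x).
  apply: (tensor_ext (f := dG n \o g n.+1) (g := g n \o d n) (tb n.+1)) => u v /=.
  by rewrite hg hdG hd hg cpsi.
have gf x : g i.+1 (f i.+1 x) = dG i.+1 (t i.+1 x) + t i (dG i x) + x.
  pose k : {linear TG i.+1 -> TG i.+1} := dG i.+1 \o t i.+1 \+ (t i \o dG i) \+ idfun.
  have -> : dG i.+1 (t i.+1 x) + t i (dG i x) + x = k x by [].
  apply: (tensor_ext (f := g i.+1 \o f i.+1) (tbG i.+1)) => u v /=.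
  by rewrite hf hg ht !hdG ht -!linearDl -hs.
exists (f i.+1); split=> x dx; first by rewrite df dx linear0.
move=> [y _ E]; exists (g i.+2 y - t i.+1 x) => //.
rewrite linearB dg E gf dx linear0 addr0.
by rewrite addrAC subrr add0r.
Qed.

(** Strict chains between boundaries and cycles of the complex on [G] survive in every module
    representing Tor, because [Tor_retract] embeds one homology in the other. *)
Lemma Tor_chain M N H i (G : proj_resolution M) (TG : nat -> lmodType R)
    (bG : forall n, {bilinear G n -> N -> TG n}) (dG : forall n, {linear TG n.+1 -> TG n})
    k (c : nat -> set (TG i.+1)) :
  is_Tor i.+1 M N H -> tensor_complex bG dG ->
  (forall j, (j <= k)%N -> [/\ submodule (c j), range (dG i.+1) `<=` c j &
     c j `<=` [set x | dG i x = 0]]) ->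
  (forall j, (j < k)%N -> c j `<` c j.+1) ->
  exists c' : nat -> set H, (forall j, (j <= k)%N -> submodule (c' j)) /\
    forall j, (j < k)%N -> c' j `<` c' j.+1.
Proof.
move=> [P [T [b [d [tb hd [h [hlin _ hB]]]]]]] tG hc cS.
have [f [fZ fB]] := Tor_retract i (conj tb hd) tG.
have h0 : h 0 = 0.
  by apply/hB; [exact: (submod0 (submod_ker (d i)))|exact: (submod0 (submod_range (d i.+1)))].
exists (fun j => [set h (f x) | x in c j]); split=> j hj.
  have [hcj _ cZ] := hc j hj; split; first by exists 0; [exact: submod0|rewrite linear0].
  move=> a _ _ [x cx <-] [y cy <-]; exists (a *: x + y); first exact: hcj.2.
  by rewrite linearP hlin //; apply: fZ; exact: cZ.
have [cc ncc] := cS j hj; split.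
  by move=> _ [x cx <-]; exists x => //; exact: cc.
move=> hcc; apply: ncc => x cx.
have [_ _ cZ] := hc j.+1 hj; have [hcj cB cZ'] := hc j (ltnW hj).
have [|y cy E] := hcc (h (f x)); first by exists x.
rewrite -[x](subrK y); apply: submodD => //; apply: cB.
have Zxy : dG i (x - y) = 0 by rewrite linearB (cZ _ cx) (cZ' _ cy) subrr.
apply: fB => //.
apply/(hB _ (fZ _ Zxy)).
rewrite linearB -scaleN1r addrC hlin; last 2 first.
- by apply: fZ; exact: cZ'.
- by apply: fZ; exact: cZ.
by rewrite E scaleN1r addrC subrr.
Qed.

End Tensor.

(** * Free modules tensored with Frobenius *)

Section FrobeniusTensor.
Variables (R : comNzRingType) (p : nat) (hp : p \in [pchar R]) (e : nat).

Definition frobn of p \in [pchar R] := fun x : R => x ^+ (p ^ e).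
Local Notation F := (frobn hp).

Fact frobn_zmod_morphism : zmod_morphism F.
Proof.
move=> x y; apply/eqP; rewrite eq_sym subr_eq eq_sym /frobn -exprDn_pchar ?subrK //.
by rewrite pnatX pnatE ?(pcharf_prime hp) // hp.
Qed.

Fact frobn_monoid_morphism : monoid_morphism F.
Proof. by split=> [|x y]; rewrite /frobn ?expr1n ?exprMn. Qed.

HB.instance Definition _ := GRing.isZmodMorphism.Build R R F frobn_zmod_morphism.
HB.instance Definition _ := GRing.isMonoidMorphism.Build R R F frobn_monoid_morphism.

Local Notation eR := (frob_module hp e R^o).
Local Notation eV n := (frob_module hp e 'rV[R]_n).

Lemma frob_scaleE (N : lmodType R) a (x : frob_module hp e N) :
  a *: x = (F a *: (x : N)) :> N.
Proof. by []. Qed.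

(** Write v^[q] for [v] with its entries raised to the power q. Sending v, y to y v^[q] identifies
    the tensor product of R^n and [eR] with [eV n]; the map induced by a matrix D is then
    multiplication by D^[q]. *)
Definition frob_pair n (v : 'rV[R]_n) (y : eR) : eV n := (y : R) *: map_mx F v.

Fact frob_pair_linearl n (y : eR) : linear ((@frob_pair n)^~ y).
Proof.
move=> a u v; apply/rowP => i; rewrite /frob_pair frob_scaleE !mxE rmorphD rmorphM.
by rewrite mulrDr mulrCA.
Qed.

Fact frob_pair_linearr n (v : 'rV[R]_n) : linear (frob_pair v).
Proof.
move=> a x y; apply/rowP => i; rewrite /frob_pair frob_scaleE !mxE.
by rewrite mulrDl mulrA.
Qed.

Definition frob_pairing n : {bilinear 'rV[R]_n -> eR -> eV n} :=
  mkbilin (@frob_pair_linearl n) (@frob_pair_linearr n).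

Lemma is_tensor_frob_pairing n : is_tensor (frob_pairing n).
Proof.
move=> W c.
(* Forced by the decomposition of [w] as the sum of the pairings of the basis vectors with its
   coordinates. *)
pose g (w : eV n) : W := \sum_i c (delta_mx 0 i) ((w : 'rV[R]_n) 0 i : eR).
have lg : linear g.
  move=> a u v; rewrite /g scaler_sumr -big_split; apply: eq_bigr => i _ /=.
  rewrite frob_scaleE !mxE -linearZr -linearDr.
  by [].
exists (mklin lg); split=> [u v|h hh w] /=.
  rewrite [in RHS](row_sum_delta u) linear_sumlz; apply: eq_bigr => i _.
  by rewrite linearZl -linearZr !mxE mulrC.
rewrite [w in LHS](row_sum_delta (w : 'rV[R]_n)).
rewrite linear_sum; apply: eq_bigr => i _; rewrite -hh; congr (h _).
by rewrite /= /frob_pair map_delta_mx.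
Qed.

Definition frob_mulmx n k (D : 'M[R]_(n, k)) (v : eV n) : eV k := (v : 'rV[R]_n) *m map_mx F D.

Fact frob_mulmx_linear n k (D : 'M[R]_(n, k)) : linear (frob_mulmx D).
Proof. by move=> a u v; rewrite /frob_mulmx !frob_scaleE mulmxDl -scalemxAl. Qed.

HB.instance Definition _ n k (D : 'M[R]_(n, k)) :=
  GRing.isLinear.Build R (eV n) (eV k) *:%R (frob_mulmx D) (frob_mulmx_linear D).

Lemma frob_mulmx_pairing n k (D : 'M[R]_(n, k)) v y :
  frob_mulmx D (frob_pairing n v y) = frob_pairing k (v *m D) y.
Proof. by rewrite /frob_mulmx /= /frob_pair -scalemxAl map_mxM. Qed.

End FrobeniusTensor.
Arguments frob_mulmx {R p} hp e {n k} D v.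

(** * Lower bound for the Frobenius homology *)

(** Provides [K:K^p]^e elements independent over K^q. The [maxn] replaces the default degree 0 by 1,
    for which the single element 1 serves. *)
Lemma frobenius_independent (K : fieldType) (p : nat) (hp : p \in [pchar K]) (e : nat) :
  exists b : 'I_((maxn (frob_degree p K) 1) ^ e) -> K,
    forall c : 'I_((maxn (frob_degree p K) 1) ^ e) -> K,
      \sum_l frobn e hp (c l) * b l = 0 -> forall l, c l = 0.
Proof.
have p_gt0 : (0 < p)%N by apply: prime_gt0; exact: pcharf_prime hp.
set D := maxn _ _.
have [b1 hb1] : exists b1 : 'I_D -> K,
    forall c : 'I_D -> K, \sum_l c l ^+ p * b1 l = 0 -> forall l, c l = 0.
  have [[n [b hb]]|no] := pselect (exists n, is_frob_degree p K n); last first.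
    have D1 : D = 1%N.
      by rewrite /D /frob_degree; case: xgetP => // n _ hn; case: no; exists n.
    rewrite D1; exists (fun=> 1) => c; rewrite big_ord1 mulr1.
    by move=> /eqP; rewrite expf_eq0 p_gt0 => /eqP c0 l; rewrite (ord1 l).
  have : is_frob_degree p K (frob_degree p K).
    by rewrite /frob_degree; case: xgetP => // /(_ n); case; exists b.
  rewrite /D; case: (frob_degree p K) => [|n'] [b' hb'].
    have [c [[_ /eqP + _]]] := hb' 1.
    by rewrite big_ord0 oner_eq0.
  rewrite (maxn_idPl _) //; exists b' => c c0 l.
  (* The zero family and the given relation are two expansions of 0, so uniqueness equates them. *)
  have [c' [_ uc]] := hb' 0.
  have E1 : c' = [ffun=> 0].
    apply: uc; split; last by rewrite big1 // => i _; rewrite ffunE mul0r.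
    by move=> i; exists 0; rewrite ffunE expr0n -(prednK p_gt0).
  have : c' = [ffun l => c l ^+ p].
    apply: uc; split; first by move=> i; exists (c i); rewrite ffunE.
    by rewrite -[LHS]c0; apply: eq_bigr => i _; rewrite ffunE.
  rewrite E1 => /esym.
  by move=> /ffunP/(_ l); rewrite !ffunE => /eqP; rewrite expf_eq0 p_gt0 => /eqP.
suff [I [b [<- hb]]] : exists (I : finType) (b : I -> K), #|I| = (D ^ e)%N /\
    forall c : I -> K, \sum_l c l ^+ (p ^ e) * b l = 0 -> forall l, c l = 0.
  exists (fun l => b (enum_val l)) => c c0 l.
  rewrite -[l]enum_valK; apply: (hb (fun i => c (enum_rank i))).
  rewrite (reindex (@enum_val I I)) /=.
    by rewrite -[RHS]c0; apply: eq_bigr => i _; rewrite enum_valK.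
  by exists enum_rank => i _; [exact: enum_valK|exact: enum_rankK].
elim: e => [|e [I [b [cI hb]]]].
  exists unit, (fun=> 1); split; first by rewrite card_unit.
  move=> c; rewrite (bigD1 tt) //= big1 ?addr0; last by case.
  by rewrite expn0 expr1 mulr1 => c0 [].
(* A relation over K^(p^(e+1)) regroups into one among the [b l] whose coefficients are the p^e-th
   powers of the sums of c(l,i)^p b1(i); independence is then used twice. *)
exists (I * 'I_D)%type, (fun l => b l.1 * b1 l.2 ^+ (p ^ e)); split.
  by rewrite card_prod cI card_ord expnSr.
move=> c c0; suff H l : \sum_i c (l, i) ^+ p * b1 i = 0.
  by case=> l i; apply: (hb1 (fun i => c (l, i))).
apply: (hb (fun l => \sum_i c (l, i) ^+ p * b1 i)).
have E : \sum_l \sum_i c (l, i) ^+ (p ^ e.+1) * (b l * b1 i ^+ (p ^ e)) = 0.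
  by rewrite pair_bigA -[RHS]c0; apply: eq_bigr => -[].
rewrite -[RHS]E {E c0}.
apply: eq_bigr => {}l _; rewrite -[_ ^+ (p ^ e)]/(frobn e hp _) rmorph_sum mulr_suml.
apply: eq_bigr => i _; rewrite rmorphM /= /frobn -exprM -expnS -mulrA.
by congr (_ * _); rewrite mulrC.
Qed.

(** * Nonzerodivisors and descent of injectivity along Frobenius *)

Section Nzd.
Variables (R : comNzRingType) (x : R).
Hypothesis x_nzd : forall y, x * y = 0 -> y = 0.

Lemma nzdX n (y : R) : x ^+ n * y = 0 -> y = 0.
Proof. by elim: n y => [|n IH] y; rewrite ?mul1r // exprS -mulrA => /x_nzd/IH. Qed.

Lemma nzdX_mx n k l (v : 'M[R]_(k, l)) : x ^+ n *: v = 0 -> v = 0.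
Proof.
move=> /matrixP v0; apply/matrixP => i j; rewrite mxE;
by apply: (@nzdX n); have := v0 i j; rewrite !mxE.
Qed.

Lemma nzd_mx k l (v : 'M[R]_(k, l)) : x *: v = 0 -> v = 0.
Proof. by rewrite -[x]expr1; exact: nzdX_mx. Qed.

(** Injectivity of A^[q] forces B^[q] = 0, so the homotopy identity becomes x^q I = (AS)^[q] and
    determinants give x^(qa) = det(AS)^q. But det(AS) kills the kernel of [A], by the adjugate
    identity, and x is a nonzerodivisor. *)
Lemma frobenius_injective (p e : nat) (hp : p \in [pchar R]) a b c
    (A : 'M[R]_(a, b)) (B : 'M[R]_(c, a)) (S : 'M[R]_(b, a)) (S' : 'M[R]_(a, c)) :
  B *m A = 0 -> x%:M = S' *m B + A *m S ->
  (forall z : 'rV_a, z *m map_mx (frobn e hp) A = 0 -> z = 0) ->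
  forall v : 'rV_a, v *m A = 0 -> v = 0.
Proof.
move=> BA xE FA v vA; set F := frobn e hp in FA.
have FB : map_mx F B = 0.
  apply/row_matrixP => i; rewrite row0; apply: FA.
  by rewrite -row_mul -map_mxM BA map_mx0 row0.
have : (F x)%:M = map_mx F (A *m S).
  by rewrite -map_scalar_mx xE map_mxD !map_mxM FB mulmx0 add0r.
move=> /(congr1 determinant); rewrite det_scalar det_map_mx => dF.
have dE : x ^+ (p ^ e * a) = \det (A *m S) ^+ (p ^ e) by rewrite exprM; exact: dF.
have : \det (A *m S) *: v = 0.
  by rewrite -mul_mx_scalar -mul_mx_adj !mulmxA vA !mul0mx.
move=> dv; apply: (@nzdX_mx (p ^ e * a)); rewrite dE.
have [p' E] : exists p', (p ^ e = p'.+1)%N.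
  exists (p ^ e).-1; rewrite prednK // expn_gt0 prime_gt0 //.
  exact: pcharf_prime hp.
by rewrite E exprSr -scalerA dv scaler0.
Qed.

End Nzd.

(** * Long strict chains in the Frobenius homology *)

Section FrobeniusChain.
Variables (R : comNzRingType) (m : set R^o) (K : fieldType) (pi : {rmorphism R -> K}).
Hypotheses (R_local : local_ring m) (K_residue : residue_map m pi).
Hypothesis R_noetherian : noetherian R.
Variables (p e : nat) (hp : p \in [pchar R]).
Local Notation F := (frobn e hp).
Variable x : R.
Hypotheses (x_nzd : forall y, x * y = 0 -> y = 0) (pi_x : pi x = 0).
Variables (n : nat) (beta : 'I_n -> R).
Hypothesis n_gt0 : (0 < n)%N.
Hypothesis beta_ind : forall c : 'I_n -> R,
  pi (\sum_l F (c l) * beta l) = 0 -> forall l, pi (c l) = 0.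
Variables (a b c s : nat) (A : 'M[R]_(a, b)) (B : 'M[R]_(c, a)).
Hypothesis BA0 : B *m A = 0.
Hypothesis B_div : forall i j, exists y, F (B i j) = x ^+ s * y.
Local Notation Z := [set z : 'rV[R]_a | z *m map_mx F A = 0].

Section Strata.
Variables (k : nat) (f : {linear 'rV[R]_k.+1 -> 'rV[R]_a}).
Hypotheses (f_range : range f = Z) (f_min : minimal_map pi f).

(* With w the first generator f (delta_mx 0 0) of Z and mZ the product of the
   maximal ideal with Z, [layer j i] is the subgroup of x^j Z formed by
   x^j (mZ + R^q beta_0 w + ... + R^q beta_(i-1) w). *)
Definition stratum (i : nat) : set 'rV[R]_k.+1 := [set v | exists2 u : 'I_n -> R,
  (forall l : 'I_n, (i <= l)%N -> u l = 0) &
  map_mx pi v = map_mx pi ((\sum_l F (u l) * beta l) *: delta_mx 0 0)].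

Definition layer (j i : nat) : set (frob_module hp e 'rV[R]_a) :=
  [set x ^+ j *: f v | v in stratum i].

Lemma stratum_max v i : map_mx pi v = 0 -> stratum i v.
Proof.
move=> v0; exists (fun=> 0) => //.
by rewrite big1 ?scale0r ?map_mx0 // => l _; rewrite rmorph0 mul0r.
Qed.

Lemma submod_layer j i : submodule (layer j i).
Proof.
split; first by exists 0; [apply: stratum_max; exact: map_mx0|rewrite linear0 scaler0].
move=> r _ _ [v [u u0 vE] <-] [v' [u' u'0 vE'] <-].
exists (F r *: v + v'); last first.
  by rewrite frob_scaleE linearP scalerDr !scalerA [F r * _]mulrC.
exists (fun l => r * u l + u' l) => [l il|]; first by rewrite u0 // u'0 // mulr0 addr0.
rewrite map_mxD [map_mx pi (F r *: v)]map_mxZ vE vE' -map_mxZ -map_mxD scalerA -scalerDl.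
congr (map_mx pi (_ *: _)); rewrite mulr_sumr -big_split; apply: eq_bigr => l _ /=.
by rewrite rmorphD rmorphM mulrDl mulrA.
Qed.

Lemma layer_cycles j i : layer j i `<=` Z.
Proof.
move=> _ [v _ <-] /=; rewrite -scalemxAl.
have : Z (f v) by rewrite -f_range; exists v.
by move=> /= ->; rewrite scaler0.
Qed.

(** B^[q] is x^s times a matrix. As [x] is a nonzerodivisor, that matrix also maps into [Z]; hence
    the boundaries lie in x^s Z, which for j < s is contained in x^j mZ. *)
Lemma boundaries_layer j i : (j < s)%N ->
  range (frob_mulmx hp e B) `<=` layer j i.
Proof.
move=> js _ [w _ <-].
pose Y i j := sval (cid (B_div i j)).
have hY i' j' : F (B i' j') = x ^+ s * Y i' j' by exact: (svalP (cid (B_div i' j'))).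
have FB : map_mx F B = x ^+ s *: (\matrix_(i, j) Y i j).
  by apply/matrixP => i' j'; rewrite !mxE hY.
pose u := (w : 'rV_c) *m (\matrix_(i, j) Y i j).
have wE : frob_mulmx hp e B w = x ^+ s *: u by rewrite /frob_mulmx FB -scalemxAr.
have : Z u.
  apply: (nzdX_mx x_nzd (n := s)); rewrite scalemxAl -wE /frob_mulmx -mulmxA -map_mxM.
  by rewrite BA0 map_mx0 mulmx0.
rewrite -f_range => -[v _ fv].
exists (x ^+ (s - j) *: v).
  apply: stratum_max; rewrite map_mxZ rmorphXn /= pi_x expr0n subn_eq0 leqNgt js.
  by rewrite scale0r.
by rewrite linearZ /= scalerA -exprD subnKC ?wE ?fv // ltnW.
Qed.

(** If x^j beta_i w already lay in the smaller layer, minimality of [f] would make beta_i, modulo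
    the maximal ideal, a combination of the earlier [beta] with q-th powers as coefficients. *)
Lemma layer_proper j (i : nat) : (i < n)%N -> layer j i `<` layer j i.+1.
Proof.
move=> hi; split.
  move=> _ [v [u u0 vE] <-]; exists v => //; exists u => // l il.
  by apply: u0; exact: ltnW.
pose i0 := Ordinal hi.
move=> /(_ (x ^+ j *: f (beta i0 *: delta_mx 0 0))) [|v [u u0 vE] E].
  exists (beta i0 *: delta_mx 0 0) => //.
  exists (fun l => (l == i0)%:R) => [l il|].
    by rewrite -val_eqE /= gtn_eqF.
  rewrite (bigD1 i0) //= eqxx rmorph1 mul1r big1 ?addr0 //.
  by move=> l /negPf ->; rewrite rmorph0 mul0r.
have : f (beta i0 *: delta_mx 0 0 - v) = 0.
  apply: (nzdX_mx x_nzd (n := j)).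
  by rewrite linearB scalerBr -E subrr.
move=> /f_min/(_ 0); rewrite !mxE !eqxx mulr1 rmorphB.
have -> : pi (v 0 0) = pi (\sum_l F (u l) * beta l).
  by move/rowP: vE => /(_ 0); rewrite !mxE !eqxx mulr1.
rewrite -rmorphB => h.
have /(_ _ i0) := @beta_ind (fun l => (l == i0)%:R - u l).
rewrite eqxx u0 // subr0 rmorph1 => h1.
suff /eqP : (1 : K) = 0 by rewrite oner_eq0.
apply: h1; rewrite -[RHS]h; congr (pi _).
under eq_bigr do rewrite rmorphB mulrBl.
rewrite sumrB; congr (_ - _).
rewrite (bigD1 i0) //= eqxx rmorph1 mul1r big1 ?addr0 //.
by move=> l /negPf ->; rewrite rmorph0 mul0r.
Qed.

Lemma layerS j i i' : layer j.+1 i `<=` layer j i'.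
Proof.
move=> _ [v _ <-]; exists (x *: v); last by rewrite linearZ /= scalerA exprSr.
by apply: stratum_max; rewrite map_mxZ pi_x scale0r.
Qed.

End Strata.

(** The layers are run through from level s - 1 down to level 0, with [n] steps for each power of
    [x]. The start at s - 1 is dictated by [boundaries_layer]. *)
Lemma frobenius_homology_chain : (exists2 z, Z z & z != 0) ->
  exists ch : nat -> set (frob_module hp e 'rV[R]_a),
   (forall t, (t <= s.-1 * n)%N -> [/\ submodule (ch t),
      range (frob_mulmx hp e B) `<=` ch t & ch t `<=` [set z | frob_mulmx hp e A z = 0]]) /\
   forall t, (t < s.-1 * n)%N -> ch t `<` ch t.+1.
Proof.
move=> [z Zz z0].
have hZ : submodule Z by exact: (submod_ker (mulmxr (map_mx F A))).
have [[|k] [f [rf mf]]] := minimal_generators R_local K_residue (noetherian_rV R_noetherian hZ).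
  case/eqP: z0; have : range f z by rewrite rf.
  by move=> [v _ <-]; rewrite [v]thinmx0 linear0.
have [s0|s_gt0] := posnP s.-1.
  exists (fun=> Z); rewrite s0 mul0n; split=> // t _; split=> //.
    exact: (submod_ker (frob_mulmx hp e A)).
  move=> _ [w _ <-] /=; rewrite /frob_mulmx -mulmxA -map_mxM BA0 map_mx0.
  by rewrite mulmx0.
have hs : s = s.-1.+1 by case: (s) s_gt0.
exists (fun t => layer f (s.-1 - t %/ n) (t %% n)); split=> t ht.
  split; [exact: submod_layer| |exact: layer_cycles].
  by apply: boundaries_layer; rewrite // [leqRHS]hs ltnS leq_subr.
have tn : (t %/ n < s.-1)%N by rewrite ltn_divLR.
have [h|h] := ltnP (t %% n).+1 n.
  have E : t.+1 = (t %/ n * n + (t %% n).+1)%N by rewrite addnS -divn_eq.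
  rewrite [in X in _ `<` X]E divnMDl // modnMDl (divn_small h) (modn_small h) addn0.
  by apply: layer_proper => //; exact: ltn_pmod.
have E : t.+1 = ((t %/ n).+1 * n)%N.
  rewrite mulSn [in LHS](divn_eq t n) -addnS addnC; congr (_ + _)%N.
  by apply/eqP; rewrite eqn_leq h ltn_pmod.
rewrite [in X in _ `<` X]E mulnK // modnMl.
have -> : (s.-1 - t %/ n = (s.-1 - (t %/ n).+1).+1)%N by rewrite -subSn // subSS.
(* At the wrap-around the last proper step of one level is composed with its inclusion in the bottom
   layer of the next. *)
have [h1 h2] := layer_proper mf (s.-1 - (t %/ n).+1).+1 (ltn_pmod t n_gt0).
split; first exact: layerS.
by move=> h3; apply: h2 => y hy; apply: h3; apply: layerS hy.
Qed.

End FrobeniusChain.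

(** * Minimal free resolutions in dimension one *)

Section MatrixResolution.
Variables (R : comNzRingType) (M : lmodType R) (r : nat -> nat).
Variables (D : forall n, 'M[R]_(r n.+1, r n)) (aug : {linear 'rV[R]_(r 0%N) -> M}).
Hypothesis aug_surj : forall y, exists x, aug x = y.
Hypothesis exact0 : forall x, aug x = 0 <-> exists y : 'rV_(r 1%N), y *m D 0%N = x.
Hypothesis exactS : forall n (x : 'rV_(r n.+1)),
  x *m D n = 0 <-> exists y : 'rV_(r n.+2), y *m D n.+1 = x.

Definition matrix_resolution : proj_resolution M :=
  @ProjResolution R M (fun n => 'rV[R]_(r n)) (fun n => mulmxr (D n)) aug
    (fun n => @projective_rV R (r n)) aug_surj exact0 exactS.

Lemma mulD0 n : D n.+1 *m D n = 0.
Proof.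
apply/row_matrixP => i; rewrite row0 row_mul; apply/exactS.
by exists (delta_mx 0 i); rewrite -rowE.
Qed.

(** Multiplication by [x] is a chain map inducing 0 on [M], hence null-homotopic. *)
Lemma scalar_homotopy (x : R) : (forall v : M, x *: v = 0) ->
  exists S : forall n, 'M[R]_(r n, r n.+1),
    forall n, x%:M = S n.+1 *m D n.+1 + D n *m S n.
Proof.
move=> xM; pose chi n : {linear 'rV[R]_(r n) -> 'rV[R]_(r n)} := mulmxr (x%:M).
have [||s [_ hs]] := @null_homotopy R M matrix_resolution matrix_resolution chi.
- by move=> n v /=; rewrite !mul_mx_scalar scalemxAl.
- by move=> v; rewrite /= mul_mx_scalar linearZ /= xM.
exists (fun n => lin1_mx (s n)) => n; apply/row_matrixP => i.
rewrite !rowE mulmxDr !mulmxA !mul_rV_lin1 -[LHS]/(chi n.+1 (delta_mx 0 i)).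
exact: hs.
Qed.

Variables (K : fieldType) (pi : {rmorphism R -> K}).
Hypothesis D_min : forall n, map_mx pi (D n) = 0.

Lemma map_mul_D n k (w : 'M[R]_(k, r n.+1)) : map_mx pi (w *m D n) = 0.
Proof. by rewrite map_mxM D_min mulmx0. Qed.

Lemma map_delta_neq0 k (i : 'I_k) : map_mx pi (delta_mx 0 i : 'rV_k) <> 0.
Proof.
by move=> /rowP/(_ i); rewrite !mxE !eqxx rmorph1 => /eqP; rewrite oner_eq0.
Qed.

Lemma rank_eq0 k : (forall i : 'I_k, False) -> k = 0%N.
Proof. by case: k => // k /(_ ord0). Qed.

(** Where [P] vanishes, the identity of the minimal resolution is a sum of homotopy terms, each with
    a factor [D]; modulo the maximal ideal this kills every basis vector. *)
Lemma rank_finite_resolution (P : proj_resolution M) N :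
  (forall j, (N < j)%N -> forall x : P j, x = 0) -> forall j, (N < j)%N -> r j = 0%N.
Proof.
move=> P0; set G := matrix_resolution.
have [phi [psi [s [_ _ hs]]]] := resolution_retract G P.
case=> // j Nj; apply: rank_eq0 => i; apply: (@map_delta_neq0 _ i).
have := hs j (delta_mx 0 i); rewrite /= (P0 _ Nj (phi _ _)) linear0.
move=> /esym/(congr1 (map_mx pi)); rewrite !map_mxD map_mx0 map_mul_D add0r.
by rewrite -[s j _]mul_rV_lin1 map_mxM map_mul_D mul0mx add0r.
Qed.

Lemma rank_zero_module : (forall v : M, v = 0) -> forall j, (0 < j)%N -> r j = 0%N.
Proof.
move=> M0 [//|j] _; have [|S hS] := @scalar_homotopy 1; first by move=> v; rewrite (M0 v) scaler0.
apply: rank_eq0 => i; apply: (@map_delta_neq0 _ i).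
rewrite -[delta_mx _ _]mulmx1 (hS j) mulmxDr map_mxD mulmxA map_mul_D.
by rewrite mulmxA map_mxM map_mul_D mul0mx addr0.
Qed.

(** By exactness every basis vector lies in the image of the next differential, which is contained
    in the maximal ideal times the free module. *)
Lemma rank_succ_of_D0 j : D j = 0 -> r j.+1 = 0%N.
Proof.
move=> D0; apply: rank_eq0 => i; apply: (@map_delta_neq0 _ i).
have /exactS[y <-] : (delta_mx 0 i : 'rV_(r j.+1)) *m D j = 0 by rewrite D0 mulmx0.
exact: map_mul_D.
Qed.

Lemma injective_D_ranks i : (forall v : 'rV_(r i.+1), v *m D i = 0 -> v = 0) ->
  forall j, (i.+1 < j)%N -> r j = 0%N.
Proof.
move=> inj; elim=> // j IH; rewrite ltnS leq_eqVlt => /orP[/eqP <-|ij].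
  apply: rank_succ_of_D0; apply/row_matrixP => k; rewrite row0.
  by apply: inj; rewrite -row_mul mulD0 row0.
apply: rank_succ_of_D0; apply/matrixP => k l.
by have := ltn_ord l; rewrite [ltnRHS]IH.
Qed.

Variables (x u : R).
Hypothesis x_nzd : forall y, x * y = 0 -> y = 0.
Hypothesis u_notin : ~ (exists y, u = x * y).
Hypothesis u_socle : forall b, pi b = 0 -> exists y, u * b = x * y.

(* Auslander-Buchsbaum in depth one: modulo x, D j.+1 stays injective because its
   cokernel embeds in a free module, but u kills it because its entries lie in
   the maximal ideal. *)
Lemma rank_descent j : r j.+3 = 0%N -> r j.+2 = 0%N.
Proof.
move=> r0; apply: rank_eq0 => i; apply: u_notin.
have pD l : pi (D j.+1 i l) = 0 by have /matrixP/(_ i l) := D_min j.+1; rewrite !mxE.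
pose w := \row_l sval (cid (u_socle (pD l))).
have wE : x *: w = (u *: delta_mx 0 i) *m D j.+1.
  apply/rowP => l; rewrite -scalemxAl -rowE !mxE.
  by case: cid => y /= ->.
(* Since w = w' D, the vector u e_i - x w' is a cycle; the next rank is 0, so it vanishes and [u]
   would be a multiple of [x]. *)
have /exactS[w' w'E] : w *m D j = 0.
  apply: (nzd_mx x_nzd).
  by rewrite scalemxAl wE -mulmxA mulD0 mulmx0.
have /exactS[y yE] : (u *: delta_mx 0 i - x *: w') *m D j.+1 = 0.
  by rewrite mulmxBl -wE -scalemxAl w'E subrr.
have y0 : y = 0 by apply/rowP => k; have := ltn_ord k; rewrite [ltnRHS]r0.
move: yE; rewrite y0 mul0mx => /esym/eqP; rewrite subr_eq0 => /eqP/rowP/(_ i).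
by rewrite !mxE !eqxx mulr1 => ->; exists (w' 0 i).
Qed.

Lemma rank_finite_le2 N : (forall j, (N < j)%N -> r j = 0%N) ->
  forall j, (1 < j)%N -> r j = 0%N.
Proof.
move=> rN; have H k : forall j, (N < k + j.+2)%N -> r j.+2 = 0%N.
  elim: k => [|k IH] j h; first exact: rN.
  by apply: rank_descent; apply: IH; rewrite addnS.
by case=> [|[|j]] // _; apply: (H N); rewrite -addSnnS ltn_addr.
Qed.

End MatrixResolution.

(** * The equivalence *)

Lemma module_length_ge (RR : realType) (R : comNzRingType) (V : lmodType R) k
    (c : nat -> set V) : (forall j, (j <= k)%N -> submodule (c j)) ->
  (forall j, (j < k)%N -> c j `<` c j.+1) -> (k%:R%:E <= module_length RR V)%E.
Proof. by move=> h1 h2; apply: ereal_sup_ubound; exists k => //; exists c. Qed.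

Lemma module_length_zero (RR : realType) (R : comNzRingType) (V : lmodType R) :
  (forall v : V, v = 0) -> module_length RR V = 0%E.
Proof.
move=> V0; apply/eqP; rewrite eq_le; apply/andP; split.
  apply: ge_ereal_sup => _ [[|k] [c [hc cS]] <-] //.
  have [_] := cS 0%N isT; case=> v _; rewrite (V0 v); apply: submod0; exact: hc.
by apply: (@module_length_ge RR R V 0 (fun=> setT)).
Qed.

(** Turns the real power q^(1+alpha) into the integer q [K:K^p]^e, to be compared with lengths of
    chains. *)
Lemma frob_normalization (RR : realType) (p : nat) (K : fieldType) (e : nat) :
  (1 < p)%N ->
  (p ^ e)%:R `^ (1 + frob_alpha RR p K) =
    (p ^ e * (maxn (frob_degree p K) 1) ^ e)%:R :> RR.
Proof.
move=> p1; have p0 : 0 < p%:R :> RR by rewrite ltr0n ltnW.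
have lnp : ln p%:R != 0 :> RR by rewrite gt_eqF // ln_gt0 // ltr1n.
have pe0 : (p ^ e)%:R != 0 :> RR by rewrite pnatr_eq0 -lt0n expn_gt0 ltnW.
rewrite powRD ?pe0 ?implybT // powRr1 // natrM; congr (_ * _).
rewrite /powR (negPf pe0) natrX lnXn // /frob_alpha -[ln _ *+ e]mulr_natl mulrCA mulfVK //.
(* At the default degree 0 the convention ln 0 = 0 gives alpha = 0, in agreement with the [maxn]. *)
case: (frob_degree p K) => [|n]; first by rewrite ln0 // mulr0 expR0 exp1n.
by rewrite expRM_natl lnK ?posrE ?ltr0n // (maxn_idPl _) // natrX.
Qed.

Lemma finite_proj_dim (RR : realType) (R : comNzRingType) (M : lmodType R) n :
  has_resolution_of_length M n -> (proj_dim RR M < +oo)%E.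
Proof.
move=> hn; rewrite /proj_dim; case: ifP => _ //.
apply: le_lt_trans (ltry (n%:R : RR)); apply: ereal_inf_lbound.
by exists n.
Qed.

Lemma proj_dim_lt_pinfty (RR : realType) (R : comNzRingType) (M : lmodType R) :
  (proj_dim RR M < +oo)%E ->
  (forall v : M, v = 0) \/ exists n, has_resolution_of_length M n.
Proof.
rewrite /proj_dim; case: ifP => [/asboolP|_]; first by left.
by move=> /ereal_inf_lt[_ [n hn _] _]; right; exists n.
Qed.

(** With s = floor(q/N), this bounds (s - 1)/q below by 1/(2N), uniformly in large q. *)
Lemma divn_pred_bound (q N : nat) : (0 < N)%N -> (4 * N <= q)%N ->
  (q <= 2 * N * (q %/ N).-1)%N.
Proof.
move=> N0 hq; have := divn_eq q N; have := ltn_pmod q N0.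
set s := (q %/ N)%N; set t := (q %% N)%N => tN qE.
have s4 : (4 <= s)%N by rewrite /s leq_divRL.
have : (s = s.-1.+1)%N by case: (s) s4.
move: s.-1 => s' sE; rewrite qE sE; nia.
Qed.

Theorem corollary4p8 (RR : realType) (R : comNzRingType) (m : set R^o)
    (K : fieldType) (pi : {rmorphism R -> K}) (p : nat) (hp : p \in [pchar R])
    (R_noetherian : noetherian R) (R_local : local_ring m)
    (K_residue : residue_map m pi) (R_F_finite : F_finite hp)
    (R_dim1 : krull_dim RR R = 1%:E) (R_CM : cohen_macaulay RR m)
    (M : lmodType R) (M_finite_length : finite_length RR M) :
  [<-> forall i : nat, (1 <= i)%N -> is_frob_betti hp K i M R^o (0 : RR);
       exists i : nat, (1 <= i)%N /\ is_frob_betti hp K i M R^o (0 : RR);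
       (proj_dim RR M < +oo)%E].
Proof.
have p_gt1 : (1 < p)%N by apply: prime_gt1; exact: pcharf_prime hp.
have hpK : p \in [pchar K] by exact: (rmorph_pchar pi).
have [x0 [mx0 x0_nzd]] := exists_nzd R_CM R_dim1.
have px0 : pi x0 = 0 by apply/K_residue.2.
have [N0 x0M] := finite_length_killed R_local K_residue M_finite_length px0.
(* The extra factor [x0] keeps [x] in the maximal ideal even when [N0] is 0. *)
pose x := x0 ^+ N0.+1.
have xM (v : M) : x *: v = 0 by rewrite /x exprS -scalerA x0M scaler0.
have px : pi x = 0 by rewrite rmorphXn /= px0 expr0n.
have x_nzd y : x * y = 0 -> y = 0 by exact: nzdX.
have nil b : pi b = 0 -> exists n y, b ^+ n = x * y.
  move=> /K_residue.2 mb; apply: (pow_in_principal R_local R_dim1) => //.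
  by apply/K_residue.2.
have [u [ux um]] := exists_socle R_local K_residue R_noetherian px nil.
have [r [D [aug [aug_surj ex0 exS D_min]]]] :=
  exists_minimal_resolution R_local K_residue R_noetherian
    (finite_length_fg M_finite_length).
pose G := matrix_resolution aug_surj ex0 exS.
have [S hS] := scalar_homotopy aug_surj ex0 exS xM.
have DD := mulD0 exS.
have tG e : @tensor_complex R M (frob_module hp e R^o) G
    (fun n => frob_module hp e 'rV[R]_(r n))
    (fun n => frob_pairing hp e (r n)) (fun n => frob_mulmx hp e (D n)).
  split=> n; first exact: is_tensor_frob_pairing.
  by move=> v y; exact: frob_mulmx_pairing.
tfae.
- by move=> h; exists 1%N; split=> //; exact: h.
- move=> [i [i1 [H [torH]]]]; rewrite R_dim1 /= => limH.
  case: i i1 torH => // i _ torH.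
  suff inj : forall v : 'rV_(r i.+1), v *m D i = 0 -> v = 0.
    apply: (@finite_proj_dim _ _ _ i.+1); exists G => j ij v.
    apply/rowP => k; have := ltn_ord k.
    by rewrite [ltnRHS](injective_D_ranks exS D_min inj).
  (* Either some Frobenius power of [D i] is injective, or all have nonzero kernel and the
     normalised lengths stay away from 0. *)
  have [[e inj]|] := pselect (exists e, forall z : 'rV_(r i.+1),
      z *m map_mx (frobn e hp) (D i) = 0 -> z = 0).
    exact: (frobenius_injective x_nzd (DD i) (hS i) inj).
  move=> /forallNP noninj; exfalso.
  have pD j k : pi (D i.+1 j k) = 0.
    by have /matrixP/(_ j k) := D_min i.+1; rewrite !mxE.
  pose ne j k := projT1 (cid (nil _ (pD j k))).
  (* One positive exponent that serves all entries at once. *)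
  pose N := (\sum_j \sum_k ne j k).+1.
  have hN j k : exists y, D i.+1 j k ^+ N = x * y.
    have [y yE] : exists y, D i.+1 j k ^+ ne j k = x * y by rewrite /ne; case: cid.
    have neN : (ne j k <= N)%N.
      by apply: leqW; rewrite (bigD1 j) //= (bigD1 k) //= -addnA leq_addr.
    exists (y * D i.+1 j k ^+ (N - ne j k)).
    by rewrite mulrA -yE -exprD subnKC.
  set d := maxn (frob_degree p K) 1.
  have low e : (((p ^ e %/ N).-1 * d ^ e)%:R%:E <= module_length RR (H e))%E.
    have [b b_ind] := frobenius_independent hpK e.
    have [beta betaE] := choice (fun l => K_residue.1 (b l)).
    have d0 : (0 < d ^ e)%N by rewrite expn_gt0 leq_max orbT.
    have beta_ind (c : 'I_(d ^ e) -> R) :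
        pi (\sum_l frobn e hp (c l) * beta l) = 0 -> forall l, pi (c l) = 0.
      rewrite rmorph_sum => c0; apply: (b_ind (fun l => pi (c l))).
      rewrite -[RHS]c0; apply: eq_bigr => l _.
      by rewrite rmorphM -betaE /frobn rmorphXn.
    have B_div j k : exists y, frobn e hp (D i.+1 j k) = x ^+ (p ^ e %/ N) * y.
      have [y yE] := hN j k; exists (y ^+ (p ^ e %/ N) * D i.+1 j k ^+ (p ^ e %% N)).
      by rewrite /frobn {1}(divn_eq (p ^ e) N) exprD mulnC exprM yE exprMn mulrA.
    have [|ch [h1 h2]] := frobenius_homology_chain R_local K_residue R_noetherian
      x_nzd px d0 beta_ind (DD i) B_div.
      apply: contrapT => no; apply: (noninj e) => z Zz; apply: contrapT => /eqP z0.
      by apply: no; exists z.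
    have [c' [h3 h4]] := Tor_chain (torH e) (tG e) h1 h2.
    exact: module_length_ge h3 h4.
  suff : (((2 * N)%:R^-1)%:E <= 0%:E :> \bar RR)%E.
    by rewrite lee_fin leNgt invr_gt0 ltr0n muln_gt0.
  apply: (cvge_to_ge limH).
  (* Since e < p^e, this threshold ensures 4N <= q, as [divn_pred_bound] requires. *)
  exists (4 * N)%N => // e /= he.
  rewrite frob_normalization // lee_pdivlMr ?ltr0n ?muln_gt0 ?expn_gt0 ?(ltnW p_gt1) //=;
    last by rewrite leq_max orbT.
  apply: le_trans (low e); rewrite -EFinM lee_fin mulrC ler_pdivrMr ?ltr0n //.
  rewrite -natrM ler_nat -/d mulnAC leq_mul2r; apply/orP; right.
  rewrite mulnC; apply: divn_pred_bound => //.
  by apply: leq_trans he _; apply: ltnW; apply: ltn_expl.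
- move=> pdM.
  have [N rN] : exists N, forall j, (N < j)%N -> r j = 0%N.
    have [M0|[N [P P0]]] := proj_dim_lt_pinfty pdM.
      by exists 0%N; exact: (rank_zero_module aug_surj ex0 exS D_min M0).
    by exists N; exact: (rank_finite_resolution aug_surj ex0 exS D_min P0).
  have r2 := rank_finite_le2 exS D_min x_nzd ux um rN.
  (* The zero module is exhibited as Tor for every [e]; it remains to see that all cycles in
     positive degree vanish. *)
  case=> // i _; exists (fun=> 'rV[R]_0); split; last first.
    rewrite module_length_zero; last by move=> v; exact: thinmx0.
    under eq_fun do rewrite mul0e.
    exact: cvg_cst.
  move=> e; exists G, (fun n => frob_module hp e 'rV[R]_(r n)),
    (fun n => frob_pairing hp e (r n)), (fun n => frob_mulmx hp e (D n)).
  split; [exact: (tG e).1|exact: (tG e).2|].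
  exists (fun=> 0); split=> [a v w _ _|w|v Zv]; first by rewrite scaler0 addr0.
    exists 0; last by rewrite [w]thinmx0.
    exact: (submod0 (submod_ker (frob_mulmx hp e (D i)))).
  split=> // _; suff -> : v = 0 by exact: (submod0 (submod_range (frob_mulmx hp e (D i.+1)))).
  case: i v Zv => [|i] v Zv; last first.
    by apply/rowP => k; have := ltn_ord k; rewrite [ltnRHS]r2.
  (* As the rank in degree 2 is 0, only one term of the homotopy identity remains; its Frobenius
     power shows that x^q kills every cycle in degree 1. *)
  have DS : D 0%N *m S 0%N = x%:M.
    rewrite hS; suff -> : S 1%N = 0 by rewrite mul0mx add0r.
    by apply/matrixP => k l; have := ltn_ord l; rewrite [ltnRHS]r2.
  apply: (nzdX_mx x_nzd (n := p ^ e)).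
  rewrite -[_ ^+ _]/(frobn e hp x) -mul_mx_scalar -map_scalar_mx -DS map_mxM mulmxA.
  have -> : (v : 'rV[R]_(r 1%N)) *m map_mx (frobn e hp) (D 0%N) = 0 := Zv.
  exact: mul0mx.
Qed.
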